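(* Let $M=\{1^{k_1},2^{k_2},\ldots,n^{k_n}\}$ be a multiset with $n\ge1$ and $k_1,\ldots,k_n$ positive integers, and let $K=k_1+\cdots+k_n$. Then $$r(\mathbf{t};\overline{Q}_M)=r(\mathbf{t};n,K-n+1).$$ Furthermore, the functions $r(\mathbf{t};n,k)$ satisfy, for all $n\ge1$ and $k\ge1$, the recurrence $$r(\mathbf{t};n,k)=\sum_{m=1}^{n}W_m(\mathbf{t})\left(\binom{n-1}{m}r(\mathbf{t};n-m,k)+\binom{n-1}{m-1}r(\mathbf{t};n-m+1,k-1)\right),$$ together with $r(\mathbf{t};n,0)=r(\mathbf{t};n-1,1)$ for $n\ge2$, and the initial conditions $r(\mathbf{t};1,0)=1$ and $r(\mathbf{t};n,k)=0$ whenever $n\le0$ or $k<0$. The exponential generating function $\mathcal{R}(\mathbf{t};x,y)=\sum_{n\ge1,\,k\ge0}\frac{r(\mathbf{t};n,k)}{(n-1)!}x^ny^k$ is given by $$\mathcal{R}(\mathbf{t};x,y)=\frac{x}{1-\mathcal{W}(\mathbf{t};x)-y\cdot\mathcal{W}'(\mathbf{t};x)},$$ where the prime denotes differentiation with respect to $x$.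
   Context: $\{1^{k_1},\ldots,n^{k_n}\}$ denotes the multiset containing $k_\ell$ copies of the letter $\ell$ for each $\ell\in[n]=\{1,\ldots,n\}$; exponents equal to $1$ are omitted. A permutation (multipermutation) of $M$ is a word $\pi=\pi_1\cdots\pi_{|M|}$ in which each letter $\ell$ occurs exactly $k_\ell$ times. It is quasi-Stirling if there are no indices $j_1<j_2<j_3<j_4$ with $\pi_{j_1}=\pi_{j_3}$, $\pi_{j_2}=\pi_{j_4}$ and $\pi_{j_1}\ne\pi_{j_2}$. $\overline{Q}_M$ is the set of quasi-Stirling permutations of $M$. The decreasing runs of $\pi$ are its maximal factors $\pi_j\cdots\pi_{j'}$ of consecutive entries with $\pi_j>\pi_{j+1}>\cdots>\pi_{j'}$. $\mathrm{DR}(\pi)=(m_1,\ldots,m_n)$, where $m_j$ is the number of decreasing runs of $\pi$ of length exactly $j$. Let $\mathbf{t}=(t_1,t_2,\ldots)$ be indeterminates and $\mathbf{t}^{\mathrm{DR}(\pi)}=t_1^{m_1}t_2^{m_2}\cdots t_n^{m_n}$. Define $$r(\mathbf{t};\overline{Q}_M)=\sum_{\pi\in\overline{Q}_M}\mathbf{t}^{\mathrm{DR}(\pi)},$$ and, for $n\ge1$ and $k\ge0$, $r(\mathbf{t};n,k)=r(\mathbf{t};\overline{Q}_{M'})$ with $M'=\{1^k,2,\ldots,n\}$ (for $n=1,k=0$ the only permutation is the empty word); $r(\mathbf{t};n,k)$ is set to $0$ if $n\le0$ or $k<0$. The functions $W_n(\mathbf{t})$ are defined by the formal power series identity $$1-\sum_{n=1}^\infty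 W_n(\mathbf{t})z^n=\left(1+\sum_{n=1}^\infty t_nz^n\right)^{-1},$$ and $\mathcal{W}(\mathbf{t};x)=\sum_{n=1}^\infty W_n(\mathbf{t})\frac{x^n}{n!}$. All generating functions are formal power series. *)

(* Defs.v *)
From HB Require Import structures.
From mathcomp Require Import all_boot all_order all_algebra.
From mathcomp Require Import boolp.
From mathcomp.multinomials Require Import monalg.

Set Implicit Arguments.
Unset Strict Implicit.
Unset Printing Implicit Defensive.

Import GRing.Theory.

Local Open Scope ring_scope.

Record fps (A : Type) := Fps { fcoef : nat -> A }.

Notation "{ 'fps' A }" := (fps A) (at level 0, format "{ 'fps'  A }").

HB.instance Definition _ (A : Type) := gen_eqMixin {fps A}.
HB.instance Definition _ (A : Type) := gen_choiceMixin {fps A}.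

Section FpsRing.
Variable A : comNzRingType.
Implicit Types f g h : {fps A}.

Lemma fpsP f g : (forall n, fcoef f n = fcoef g n) <-> f = g.
Proof.
split=> [|-> //]; case: f => f; case: g => g /= fg.
by congr Fps; apply/funext.
Qed.

Definition fps_zero : {fps A} := Fps (fun _ => 0).
Definition fps_opp f : {fps A} := Fps (fun n => - fcoef f n).
Definition fps_add f g : {fps A} := Fps (fun n => fcoef f n + fcoef g n).
Definition fps_one : {fps A} := Fps (fun n => (n == 0%N)%:R).
Definition fps_mul f g : {fps A} :=
  Fps (fun n => \sum_(i < n.+1) fcoef f i * fcoef g (n - i)%N).

Fact fps_addA : associative fps_add.
Proof. by move=> f g h; apply/fpsP=> n /=; rewrite addrA. Qed.
Fact fps_addC : commutative fps_add.
Proof. by move=> f g; apply/fpsP=> n /=; rewrite addrC. Qed.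
Fact fps_add0 : left_id fps_zero fps_add.
Proof. by move=> f; apply/fpsP=> n /=; rewrite add0r. Qed.
Fact fps_addN : left_inverse fps_zero fps_opp fps_add.
Proof. by move=> f; apply/fpsP=> n /=; rewrite addNr. Qed.

HB.instance Definition _ :=
  GRing.isZmodule.Build {fps A} fps_addA fps_addC fps_add0 fps_addN.

Let tr N f : {poly A} := \poly_(i < N.+1) fcoef f i.

Let fps_mulE N f g n : (n <= N)%N ->
  fcoef (fps_mul f g) n = (tr N f * tr N g)`_n.
Proof.
move=> nN; rewrite coefM; apply: eq_bigr => i _.
rewrite !coef_poly !ltnS (leq_trans (leq_subr _ _) nN).
by rewrite (leq_trans _ nN) // -ltnS.
Qed.

Fact fps_mulC : commutative fps_mul.
Proof.
by move=> f g; apply/fpsP=> n; rewrite !(@fps_mulE n) // mulrC.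
Qed.

Fact fps_mulA : associative fps_mul.
Proof.
move=> f g h; apply/fpsP=> n.
transitivity ((tr n f * (tr n g * tr n h))`_n).
  rewrite coefM; apply: eq_bigr => i _.
  by rewrite coef_poly ltn_ord (@fps_mulE n) ?leq_subr.
rewrite mulrA coefM; apply: eq_bigr => i _.
by rewrite (@fps_mulE n) 1?coef_poly ?ltnS ?leq_subr // -ltnS.
Qed.

Fact fps_mul1 : left_id fps_one fps_mul.
Proof.
move=> f; apply/fpsP=> n /=; rewrite big_ord_recl /= mul1r subn0.
by rewrite big1 ?addr0 // => i _; rewrite mul0r.
Qed.

Fact fps_mulD : left_distributive fps_mul fps_add.
Proof.
move=> f g h; apply/fpsP=> n /=; rewrite -big_split /=.
by apply: eq_bigr => i _; rewrite mulrDl.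
Qed.

Fact fps_one_neq0 : fps_one != 0.
Proof.
apply/eqP=> /fpsP/(_ 0%N) /= /eqP.
by rewrite oner_eq0.
Qed.

HB.instance Definition _ := GRing.Zmodule_isComNzRing.Build {fps A}
  fps_mulA fps_mulC fps_mul1 fps_mulD fps_one_neq0.

(* A need not have decidable units; [fps_unitP] below is the usual criterion
   on the constant coefficient. *)
Definition fps_unit f : bool := `[< exists g, g * f = 1 >].
Definition fps_inv f : {fps A} :=
  if pselect (exists g, g * f = 1) is left e then sval (cid e) else f.

Fact fps_mulV f : fps_unit f -> fps_inv f * f = 1.
Proof.
move=> /asboolP uf; rewrite /fps_inv.
by case: pselect => // e; case: cid.
Qed.
Fact fps_unitPl f g : g * f = 1 -> fps_unit f.
Proof. by move=> gf; apply/asboolP; exists g. Qed.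
Fact fps_inv_out f : ~~ fps_unit f -> fps_inv f = f.
Proof. by move=> /asboolPn nuf; rewrite /fps_inv; case: pselect. Qed.

HB.instance Definition _ := GRing.ComNzRing_hasMulInverse.Build {fps A}
  fps_mulV fps_unitPl fps_inv_out.

Definition fpsC (a : A) : {fps A} := Fps (fun n => if n == 0%N then a else 0).
Definition fpsX : {fps A} := Fps (fun n => (n == 1%N)%:R).
Definition fps_deriv f : {fps A} := Fps (fun n => fcoef f n.+1 *+ n.+1).

Lemma fcoef_mul0 f g : fcoef (f * g) 0%N = fcoef f 0%N * fcoef g 0%N.
Proof. by rewrite /= big_ord1. Qed.

Lemma fps_unitP f :
  (f \is a GRing.unit) <-> (exists u, u * fcoef f 0%N = 1).
Proof.
split=> [uf|[u uf]].
  by exists (fcoef f^-1 0%N); rewrite -fcoef_mul0 mulVr.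
pose step s := u * ((size s == 0%N)%:R -
  \sum_(i < size s) nth 0 s i * fcoef f (size s - i)%N).
pose S := fix S n := if n is m.+1 then rcons (S m) (step (S m)) else [::].
have sS n : size (S n) = n by elim: n => //= n IH; rewrite size_rcons IH.
have nS n m : (m < n)%N -> nth 0 (S n) m = step (S m).
  elim: n => // n IH; rewrite ltnS leq_eqVlt /= nth_rcons sS.
  by case/predU1P=> [->|mn]; rewrite ?ltnn ?eqxx // mn IH.
apply: (@fps_unitPl f (Fps (fun n => step (S n)))).
apply/fpsP=> n /=; rewrite big_ord_recr /= subnn {2}/step.
rewrite -mulrA [_ * fcoef f 0%N]mulrC mulrA uf mul1r sS.
rewrite (eq_bigr (fun i : 'I_n => nth 0 (S n) i * fcoef f (n - i)%N)).
  by rewrite addrC subrK.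
by move=> i _; rewrite nS.
Qed.

End FpsRing.

(* The multiset {1^(k 1), ..., n^(k n)} as a sorted word; the permutations of
   the multiset are the words in [permutations (mset n k)]. *)
Definition mset (n : nat) (k : nat -> nat) : seq nat :=
  flatten [seq nseq (k l) l | l <- iota 1 n].

Definition quasi_stirling (w : seq nat) : bool :=
  ~~ [exists j1 : 'I_(size w), exists j2 : 'I_(size w),
      exists j3 : 'I_(size w), exists j4 : 'I_(size w),
      [&& (j1 < j2)%N, (j2 < j3)%N, (j3 < j4)%N,
          nth 0%N w j1 == nth 0%N w j3, nth 0%N w j2 == nth 0%N w j4
        & nth 0%N w j1 != nth 0%N w j2]].

(* Factors are given by the positions [(i, j)] of their first and last
   letters. *)
Definition decreasing_factor (w : seq nat) (p : 'I_(size w) * 'I_(size w)) :=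
  (p.1 <= p.2)%N && sorted gtn (take (p.2 - p.1).+1 (drop p.1 w)).

Definition decreasing_run (w : seq nat) (p : 'I_(size w) * 'I_(size w)) :=
  decreasing_factor p &&
  [forall q : 'I_(size w) * 'I_(size w),
     [&& (q.1 <= p.1)%N, (p.2 <= q.2)%N & decreasing_factor q] ==> (q == p)].

Definition num_runs (w : seq nat) (j : nat) : nat :=
  #|[set p : 'I_(size w) * 'I_(size w) |
      decreasing_run p && ((p.2 - p.1).+1 == j)]|.

(* Polynomials over [rat] in countably many indeterminates; the indeterminate
   of index 0 is never used. *)
Definition tring := {malg rat[{cmonom nat}]}.
HB.instance Definition _ := GRing.ComAlgebra.on tring.

Definition t (j : nat) : tring := << ucm j >>.

Definition tDR (n : nat) (w : seq nat) : tring :=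
  \prod_(1 <= j < n.+1) t j ^+ num_runs w j.

Definition rQ (n : nat) (k : nat -> nat) : tring :=
  \sum_(w <- permutations (mset n k) | quasi_stirling w) tDR n w.

Definition r (n k : int) : tring :=
  if (1 <= n) && (0 <= k) then
    rQ `|n|%N (fun l => if l == 1%N then `|k|%N else 1%N)
  else 0.

Definition Tser : {fps tring} := Fps (fun n => if n == 0%N then 1 else t n).

Definition W (n : nat) : tring := fcoef (1 - Tser^-1) n.

Lemma W_spec :
  1 - Fps (fun n => if n == 0%N then 0 else W n) = Tser^-1 :> {fps tring}.
Proof.
have uT : Tser \is a GRing.unit by apply/fps_unitP; exists 1; rewrite mul1r.
have T0 : fcoef Tser^-1 0%N = 1.
  by have := fcoef_mul0 Tser^-1 Tser; rewrite mulVr //= mulr1.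
apply/fpsP=> -[|n]; first by rewrite T0 /= oppr0 addr0.
by rewrite /W /= opprB addrC subrK.
Qed.

Definition Wser : {fps tring} :=
  Fps (fun n => if n == 0%N then 0 else (n`!%:R)^-1 *: W n).

(* Series in x and y are series in y whose coefficients are series in x. *)
Definition Rser : {fps {fps tring}} :=
  Fps (fun k => Fps (fun n =>
    if n == 0%N then 0 else (n.-1`!%:R)^-1 *: r n%:Z k%:Z)).

Definition xser : {fps {fps tring}} := fpsC (fpsX tring).
Definition yser : {fps {fps tring}} := fpsX {fps tring}.

Lemma Rser_denom_unit :
  1 - fpsC Wser - yser * fpsC (fps_deriv Wser) \is a GRing.unit.
Proof.
apply/fps_unitP; exists (1 - Wser)^-1.
have -> : fcoef (1 - fpsC Wser - yser * fpsC (fps_deriv Wser)) 0%N = 1 - Wser.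
  by rewrite /= big_ord1 /= mul0r subr0.
by rewrite mulVr //; apply/fps_unitP; exists 1; rewrite /= subr0 mul1r.
Qed.

(* Main.v *)
Require Import Defs.
From mathcomp Require Import all_boot all_order all_algebra.
From mathcomp Require Import zify ring.

Set Implicit Arguments.
Unset Strict Implicit.
Unset Printing Implicit Defensive.

Import GRing.Theory Num.Theory.

Local Open Scope ring_scope.

(** Give a word the weight [wt tau], the product of [tau l] over the lengths [l]
of its decreasing runs, where [tau] takes values in any commutative ring, and
let [qs_sum tau s] be the total weight of the quasi-Stirling arrangements of
the multiset [s]. Everything follows from two facts about the largest letters.

Merging ([qs_sum_merge]). If [a < b] are the two largest letters of [s], one
occurrence of [b] can be traded for an occurrence of [a] as long as another [b]
remains. The quasi-Stirling property is invariant under rotation, and around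
the circle the letters [a] form one group and the letters [b] another, so each
word has a unique rotation that begins with [b] and has all [b] before all [a]
([qs_sum_canonical]). What is left of the original is the place of its
beginning, so the sum runs over canonical words, each weighted by [cuts]: the sum
over all ways to cut it in two of the product of the two weights. As [a] and [b]
are the largest letters, a canonical word falls into chunks, each starting at
[a] or [b], and these are not joined by descents except at a [b] directly
followed by [a]. On such factorizations [cuts] obeys the Leibniz rule, hence it
does not see the order of the chunks, nor whether a chunk starts with [a] or
[b]. The first chunk [b :: X] lies between two letters [b], so [X] shares no
letter with the rest; turning it into [a :: X] and moving it next to the last
chunk [a :: Z] is a bijection that keeps the weight ([qs_sum_transfer]).

Insertion ([qs_sum_insert_max]). A letter that occurs once is never part of a
crossing, so a new maximum can be inserted at any of the places. The effect on
the weight is a derivation plus multiplication by [tau 1]. The derivation is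
encoded as the coefficient of ['X] after replacing [tau] by weights [grow tau]
in a polynomial ring, which is why [tau] and its ring have to be arbitrary.

Merging the two largest letters and then deleting the largest one, which is now
simple, shows by induction on [n] that the sum depends only on [n] and on the
size of the multiset ([qs_sum_mset]). For [1^k, 2, ..., n] the insertion rule is
a recursion in [n]. Let [V] be the inverse of the series [1 + sum tau_n z^n], so
that [W_n = - V_n] for positive [n]. The derivation sends [V_m] to
[V_(m+1) + tau_1 V_m], and with Pascal's rule this gives, by induction on [n],
the convolution identity [qs_repeat1_conv], which is the recurrence for the
[r(n,k)] and, read on exponential generating functions, the closed form. *)

(** * Words avoiding the pattern [xyxy] *)

Lemma subseq_consP (x : nat) (s w : seq nat) :
  reflect (exists j, [/\ (j < size w)%N, nth 0%N w j = x
                      & subseq s (drop j.+1 w)])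
          (subseq (x :: s) w).
Proof.
elim: w => [|y w IH]; first by apply: (iffP idP) => // -[j []].
rewrite /=; have [<-|yx] := eqVneq y x.
  apply: (iffP idP) => [sw|[j [jw _ sj]]].
    by exists 0%N; rewrite ?drop0.
  by apply: subseq_trans sj _; apply: drop_subseq.
apply: (iffP IH) => [[j [jw jx sj]]|[[|j] [jw jx sj]]].
- by exists j.+1.
- by rewrite -jx eqxx in yx.
- by exists j.
Qed.

(** The form in which crossings are handled below: subsequences, rather than
    positions, are stable under concatenation and deletion. *)
Lemma quasi_stirlingP (w : seq nat) :
  reflect (forall x y : nat, x != y -> ~~ subseq [:: x; y; x; y] w)
          (quasi_stirling w).
Proof.
have lsub m n p : (m < n)%N -> (n < p)%N -> (n - m.+1 < p - m.+1)%N by lia.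
apply: (iffP idP) => [qs x y xy|qs]; last first.
  apply/existsP=> -[j1 /existsP[j2 /existsP[j3 /existsP[j4]]]].
  case/and5P=> j12 j23 j34 /eqP e13 /andP[/eqP e24 n12].
  have /negP := qs _ _ n12; apply.
  apply/subseq_consP; exists j1; split=> //.
  apply/subseq_consP; exists (j2 - j1.+1)%N.
  rewrite size_drop nth_drop subnKC // drop_drop; split=> //.
    exact: lsub.
  rewrite addSn subnK //; apply/subseq_consP; exists (j3 - j2.+1)%N.
  rewrite size_drop nth_drop drop_drop subnKC // e13; split=> //.
    exact: lsub.
  rewrite e24.
  rewrite addSn subnK // sub1seq.
  apply/(nthP 0%N); exists (j4 - j3.+1)%N.
    by rewrite size_drop; apply: lsub.
  by rewrite nth_drop subnKC.
apply/negP=> /subseq_consP[j1 [l1 e1]] /subseq_consP[j2 [l2 e2]].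
case/subseq_consP=> j3 [l3 e3] /subseq_consP[j4 [l4 e4] _].
move: l2 e2 l3 e3 l4 e4; rewrite !drop_drop !size_drop !nth_drop.
set i2 := (j1.+1 + j2)%N; set i3 := (_ + j3)%N; set i4 := (_ + j4)%N.
move=> l2 e2 l3 e3 l4 e4.
have h2 : (i2 < size w)%N by lia.
have h3 : (i3 < size w)%N by lia.
have h4 : (i4 < size w)%N by lia.
move/negP: qs; apply; apply/existsP; exists (Ordinal l1).
apply/existsP; exists (Ordinal h2); apply/existsP; exists (Ordinal h3).
apply/existsP; exists (Ordinal h4); rewrite /= e1 e2 e3 e4 !eqxx xy /=.
by apply/and3P; split=> //; lia.
Qed.

Lemma quasi_stirling_subseq (u w : seq nat) :
  subseq u w -> quasi_stirling w -> quasi_stirling u.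
Proof.
move=> uw /quasi_stirlingP qs; apply/quasi_stirlingP=> x y /qs.
by apply: contra => /subseq_trans; apply.
Qed.

Lemma subseq_cons_catl (x : nat) (s u w : seq nat) :
  x \notin u -> subseq (x :: s) (u ++ w) = subseq (x :: s) w.
Proof.
elim: u => //= y u IH; rewrite inE negb_or eq_sym => /andP[/negPf yx xu].
by rewrite yx -IH.
Qed.

Lemma subseq_rcons_catr (x : nat) (s u w : seq nat) :
  x \notin w -> subseq (rcons s x) (u ++ w) = subseq (rcons s x) u.
Proof.
move=> xw; rewrite -subseq_rev rev_rcons rev_cat.
by rewrite subseq_cons_catl ?mem_rev // -rev_rcons subseq_rev.
Qed.

Lemma quasi_stirling_rot (i : nat) (w : seq nat) :
  quasi_stirling (rot i w) = quasi_stirling w.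
Proof.
have rot1 x v : quasi_stirling (x :: v) -> quasi_stirling (rcons v x).
  move=> /quasi_stirlingP qs; apply/quasi_stirlingP=> y z yz.
  apply/negP; rewrite -[[:: y; z; y; z]]/(rcons [:: y; z; y] z).
  have [zx|zx] := eqVneq z x.
    subst z; rewrite -subseq_rev !rev_rcons /= eqxx.
    rewrite -[[:: y; x; y]]/(rev [:: y; x; y]) subseq_rev => yxy.
    by have := qs x y; rewrite eq_sym yz /= eqxx yxy => /(_ isT).
  rewrite -[rcons v x]cats1 subseq_rcons_catr ?inE // => yzv.
  have /negP := qs y z yz; apply; apply: subseq_trans yzv _.
  exact: subseq_cons.
have rotn j v : quasi_stirling v -> quasi_stirling (rot j v).
  move=> qv; elim: j => [|j IH]; first by rewrite rot0.
  have [vj|/leqW/rot_oversize-> //] := ltnP j (size v).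
  rewrite -add1n rotD //.
  by case: (rot j v) IH => // x u /rot1; rewrite rot1_cons.
apply/idP/idP; last exact: rotn.
by move=> /(rotn (size (rot i w) - i)%N); rewrite -/(rotr _ _) rotK.
Qed.

(** A factor sharing no letter with the rest of the word cannot take part in a
    crossing with it, since all its occurrences of a letter are consecutive
    relative to any letter outside. *)
Lemma quasi_stirling_factor (u x v : seq nat) :
  (forall c, c \in x -> c \notin u ++ v) ->
  quasi_stirling (u ++ x ++ v) = quasi_stirling (u ++ v) && quasi_stirling x.
Proof.
move=> dx; apply/idP/andP=> [qs|[/quasi_stirlingP quv /quasi_stirlingP qx]].
  split; apply: quasi_stirling_subseq qs.
    by rewrite cat_subseq ?suffix_subseq.
  by apply: subseq_trans (suffix_subseq u _); apply: prefix_subseq.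
have mixed c d : c \in x -> d \notin x -> ~~ subseq [:: c; d; c] (u ++ x ++ v).
  move=> /dx; rewrite mem_cat negb_or => /andP[cu cv] dx'.
  rewrite subseq_cons_catl // -[[:: c; d; c]]/(rcons [:: c; d] c).
  rewrite subseq_rcons_catr //; apply: contra dx' => /mem_subseq; apply.
  by rewrite mem_rcons !inE eqxx !orbT.
apply/quasi_stirlingP=> c d cd; apply/negP=> sub.
have [cx|cx] := boolP (c \in x); have [dx'|dx'] := boolP (d \in x).
- have /negP := qx c d cd; apply.
  move: (dx c cx) (dx d dx'); rewrite !mem_cat !negb_or.
  move=> /andP[cu cv] /andP[du dv]; move: sub; rewrite subseq_cons_catl //.
  by rewrite -[[:: c; d; c; d]]/(rcons [:: c; d; c] d) subseq_rcons_catr.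
- have /negP := mixed c d cx dx'; apply; apply: subseq_trans sub.
  exact: (prefix_subseq [:: c; d; c] [:: d]).
- have /negP := mixed d c dx' cx; apply; apply: subseq_trans sub.
  exact: subseq_cons.
have /negP := quv c d cd; apply.
have : subseq [:: c; d; c; d] (filter (predC (mem x)) (u ++ x ++ v)).
  by rewrite subseq_filter sub /= cx dx'.
rewrite !filter_cat (_ : filter _ x = [::]) => [/subseq_trans-> //|].
  by apply: cat_subseq; apply: filter_subseq.
by rewrite -(filter_pred0 x); apply: eq_in_filter => e ex /=; rewrite ex.
Qed.

(** A pattern [xyxy] has no two equal consecutive letters, so it uses at most one
    of two adjacent copies. *)
Lemma quasi_stirling_dup (c : nat) (u v : seq nat) :
  quasi_stirling (u ++ c :: c :: v) = quasi_stirling (u ++ c :: v).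
Proof.
apply/idP/idP.
  by apply: quasi_stirling_subseq; rewrite cat_subseq // subseq_cons.
move=> /quasi_stirlingP qs; apply/quasi_stirlingP=> x y xy.
apply: contra (qs x y xy).
have alt s : sorted (fun i j => i != j) s ->
    subseq s (u ++ c :: c :: v) -> subseq s (u ++ c :: v).
  elim: u s {qs} => [|z u IH] [|d s] //=.
    have [->|dc] := eqVneq d c; last by rewrite (negPf dc).
    case: s => [|e s] //=; first by rewrite sub0seq.
    by case/andP; rewrite eq_sym => /negPf->.
  by move=> ds; case: eqVneq => _; apply: IH => //; apply: path_sorted ds.
by apply: alt; rewrite /= xy eq_sym xy.
Qed.

(** * Decreasing runs and multiplicative weights *)

Fixpoint runs (w : seq nat) : seq nat :=
  if w is x :: v then
    if runs v is l :: ls then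
      if (head 0%N v < x)%N then l.+1 :: ls else [:: 1%N, l & ls]
    else [:: 1%N]
  else [::].

(** The concatenation of [u] and [v] creates no descent. The default [0] of
    [last] makes an empty [u] qualify. *)
Definition ascent (u v : seq nat) : bool :=
  nilp v || (last 0 u <= head 0 v)%N.

Lemma ascent_drop (i : nat) (u v : seq nat) : ascent u v -> ascent (drop i u) v.
Proof.
have [iu|ui] := ltnP i (size u); last by rewrite drop_oversize // /ascent orbT.
rewrite /ascent -{1}(cat_take_drop i u) last_cat.
by case: (drop i u) (size_drop i u) => //= /eqP; rewrite eq_sym subn_eq0 leqNgt iu.
Qed.

Lemma ascent_take (i : nat) (u v : seq nat) : ascent u v -> ascent u (take i v).
Proof. by case: v i => [|y v] [|i]. Qed.

Lemma ascent_cons_max (b : nat) (u v : seq nat) :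
  all (fun x => x <= b)%N u -> ascent u (b :: v).
Proof.
case/lastP: u => // u x; rewrite all_rcons /ascent /= last_rcons.
by case/andP.
Qed.

Lemma runs_nil (w : seq nat) : nilp (runs w) = nilp w.
Proof. by case: w => //= x w; case: runs => // l ls; case: ifP. Qed.

Lemma runs_cons (x : nat) (v : seq nat) :
  runs (x :: v) = if runs v is l :: ls then
    if (head 0 v < x)%N then l.+1 :: ls else [:: 1%N, l & ls]
  else [:: 1%N].
Proof. by []. Qed.

Lemma runs_cat (u v : seq nat) : ascent u v -> runs (u ++ v) = runs u ++ runs v.
Proof.
elim: u => // x u; case: u => [|y u] IH a.
  case: v a {IH} => // y v; rewrite /ascent leqNgt => /negPf xy.
  rewrite cat1s runs_cons xy.
  by case: (runs (y :: v)) (runs_nil (y :: v)).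
rewrite cat_cons runs_cons (IH a) [runs [:: x, y & u]]runs_cons.
by case: (runs (y :: u)) (runs_nil (y :: u)) => // l ls _ /=; case: ifP.
Qed.

Lemma runs_decreasing (u : seq nat) :
  sorted gtn u -> ~~ nilp u -> runs u = [:: size u].
Proof.
elim: u => //= x [|y u] IH //= /andP[yx su] _.
by have /= -> := IH su isT; rewrite yx.
Qed.

(** Induction on the number of runs: [u] is the first run. *)
Lemma runs_ind (P : seq nat -> Prop) :
  P [::] ->
  (forall u v, ~~ nilp u -> sorted gtn u -> ascent u v -> P v -> P (u ++ v)) ->
  forall w, P w.
Proof.
move=> P0 Pcat w; have [n] := ubnP (size w); elim: n w => // n IH w.
case: w => // x w wn.
suff [u [v [suv euv auv]]] : exists u v,
    [/\ sorted gtn (x :: u), w = u ++ v & ascent (x :: u) v].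
  rewrite euv -cat_cons; apply: Pcat => //; apply: IH.
  by move: wn; rewrite euv /= size_cat !ltnS; apply: leq_trans; apply: leq_addl.
elim: w x {wn} => [|y w IHw] x; first by exists [::], [::].
have [yx|xy] := ltnP y x; last by exists [::], (y :: w).
have [u [v [suv euv auv]]] := IHw y.
by exists (y :: u), v; split; rewrite /= ?yx ?euv.
Qed.

Section Weight.
Variable A : comNzRingType.
Implicit Types (tau : nat -> A) (u v w : seq nat).

Definition wt tau w : A := \prod_(l <- runs w) tau l.

Lemma wt_nil tau : wt tau [::] = 1.
Proof. by rewrite /wt big_nil. Qed.

Lemma wt_cat tau u v : ascent u v -> wt tau (u ++ v) = wt tau u * wt tau v.
Proof. by move=> a; rewrite /wt runs_cat // big_cat. Qed.

Lemma wt_decreasing tau u :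
  sorted gtn u -> ~~ nilp u -> wt tau u = tau (size u).
Proof. by move=> su nu; rewrite /wt runs_decreasing // big_seq1. Qed.

(** With [phi] the weight itself, [cuts] adds up the weights of all the ways to
    cut a word in two; with [phi] the weight after a new maximum is put in
    front, it adds up the weights of all insertions of a maximum before some
    letter. In both cases it obeys the Leibniz rule, because a cut falls in one
    of the two factors. *)
Definition cuts tau (phi : seq nat -> A) w : A :=
  \sum_(i < size w) wt tau (take i w) * phi (drop i w).

Lemma cuts_cat tau phi u v :
    (forall u', ~~ nilp u' -> ascent u' v -> phi (u' ++ v) = phi u' * wt tau v) ->
    ascent u v ->
  cuts tau phi (u ++ v) = cuts tau phi u * wt tau v + wt tau u * cuts tau phi v.
Proof.
move=> phiM auv; rewrite /cuts size_cat big_split_ord /= mulr_suml mulr_sumr.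
congr (_ + _); apply: eq_bigr => i _.
  rewrite take_cat drop_cat ltn_ord phiM ?mulrA //; last exact: ascent_drop.
  by rewrite /nilp size_drop subn_eq0 -ltnNge.
rewrite take_cat drop_cat ltnNge leq_addr /= addKn wt_cat ?mulrA //.
exact: ascent_take.
Qed.

Definition hcoef tau n : A := if n == 0%N then 1 else tau n.

(** The coefficient of ['X] is the total weight of the results of inserting a
    new maximum at one of the first [m] places of a decreasing word of length
    [m]; a maximum inserted at the last place starts a run of length one. *)
Definition grow tau (m : nat) : {poly A} :=
  (tau m)%:P + (\sum_(i < m) hcoef tau i * tau (m.+1 - i)%N)%:P * 'X.

End Weight.

Lemma coef1M (A : nzSemiRingType) (p q : {poly A}) :
  (p * q)`_1 = p`_0 * q`_1 + p`_1 * q`_0.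
Proof. by rewrite coefM !big_ord_recl big_ord0 addr0. Qed.

Section Insertion.
Variable A : comNzRingType.
Implicit Types (tau : nat -> A) (u v w : seq nat).

Lemma grow0 tau m : (grow tau m)`_0 = tau m.
Proof. by rewrite coefD coefC coefMX addr0. Qed.

Lemma grow1 tau m :
  (grow tau m)`_1 = \sum_(i < m) hcoef tau i * tau (m.+1 - i)%N.
Proof. by rewrite coefD coefC coefMX coefC add0r. Qed.

Lemma wt_grow0 tau w : (wt (grow tau) w)`_0 = wt tau w.
Proof.
rewrite /wt; elim: (runs w) => [|l ls IH]; first by rewrite !big_nil coef1.
by rewrite !big_cons coef0M IH grow0.
Qed.

Lemma wt_grow1 tau b w : all (fun x => x < b)%N w ->
  (wt (grow tau) w)`_1 = cuts tau (wt tau \o cons b) w.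
Proof.
elim/runs_ind: w => [_|u v nu su auv IH].
  by rewrite wt_nil coef1 /cuts big_ord0.
rewrite all_cat => /andP[ub vb].
rewrite wt_cat // coef1M !wt_grow0 IH // cuts_cat //; last first.
  move=> u' nu' a; rewrite /= -cat_cons wt_cat //; move: nu' a.
  by case: u'.
rewrite addrC; congr (_ * _ + _).
rewrite wt_decreasing // grow1; apply: eq_bigr => i _.
have iu := ltn_ord i; congr (_ * _).
  rewrite /hcoef; case: eqP => [->|/eqP i0]; first by rewrite take0 wt_nil.
  have st : size (take i u) = i by rewrite size_take iu.
  rewrite wt_decreasing ?st //; last by rewrite /nilp st.
  by apply: take_sorted.
rewrite /= wt_decreasing //= ?size_drop ?subSn // 1?ltnW //.
rewrite path_sortedE; last by move=> ? ? ? /= h1 h2; apply: ltn_trans h2 h1.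
rewrite drop_sorted // andbT.
by apply/allP=> x /mem_drop; apply: (allP ub).
Qed.

(** The two terms on the right are the insertion at the end of the word and the
    insertions elsewhere. *)
Lemma wt_insert_max tau b w : all (fun x => x < b)%N w ->
  \sum_(i < (size w).+1) wt tau (take i w ++ b :: drop i w) =
    tau 1%N * wt tau w + (wt (grow tau) w)`_1.
Proof.
move=> wb; have wt_ins i : wt tau (take i w ++ b :: drop i w) =
    wt tau (take i w) * wt tau (b :: drop i w).
  apply/wt_cat/ascent_cons_max/allP => x /mem_take /(allP wb).
  exact: ltnW.
rewrite big_ord_recr /= (wt_grow1 tau wb) addrC wt_ins take_size drop_size.
rewrite [wt tau [:: b]]wt_decreasing // mulrC; congr (_ + _).
by apply: eq_bigr => i _; rewrite wt_ins.
Qed.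

End Insertion.

(** * Weighted sums over quasi-Stirling words *)

Lemma reindex_seq (A : nmodType) (T : eqType) (X Y : seq T) (f g : T -> T)
    (F G : T -> A) :
    uniq X -> uniq Y ->
    {in X, forall w, [/\ f w \in Y, g (f w) = w & F w = G (f w)]} ->
    {in Y, forall u, g u \in X /\ f (g u) = u} ->
  \sum_(w <- X) F w = \sum_(u <- Y) G u.
Proof.
move=> uX uY fX gY; rewrite [RHS](perm_big [seq f w | w <- X]) /=; last first.
  apply: uniq_perm => // [|u].
    rewrite map_inj_in_uniq // => w1 w2 /fX[_ e1 _] /fX[_ e2 _] e12.
    by rewrite -e1 e12.
  apply/idP/mapP => [Yu|[w wX ->]]; last by have [] := fX w wX.
  by have [gu eu] := gY u Yu; exists (g u).
by rewrite big_map big_seq [RHS]big_seq; apply: eq_bigr => w wX; case: (fX w wX).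
Qed.

Definition first_split (c : nat) (w : seq nat) : seq nat * seq nat :=
  (take (index c w) w, drop (index c w).+1 w).

Definition last_split (c : nat) (w : seq nat) : seq nat * seq nat :=
  let s := first_split c (rev w) in (rev s.2, rev s.1).

Lemma first_splitE (c : nat) (u v : seq nat) :
  c \notin u -> first_split c (u ++ c :: v) = (u, v).
Proof.
move=> cu; rewrite /first_split index_cat (negPf cu) /= eqxx addn0.
by rewrite take_size_cat // -cat_rcons drop_size_cat // size_rcons.
Qed.

Lemma last_splitE (c : nat) (u v : seq nat) :
  c \notin v -> last_split c (u ++ c :: v) = (u, v).
Proof.
move=> cv; rewrite /last_split rev_cat rev_cons cat_rcons.
by rewrite first_splitE ?mem_rev //= !revK.
Qed.

Lemma first_splitP (c : nat) (w : seq nat) :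
  c \in w -> exists u v, w = u ++ c :: v /\ c \notin u.
Proof.
move=> cw; exists (take (index c w) w), (drop (index c w).+1 w); split.
  rewrite -[LHS](cat_take_drop (index c w)); congr (_ ++ _).
  by rewrite (drop_nth c) ?index_mem // nth_index.
by rewrite in_take ?index_size // ltnn.
Qed.

Lemma last_splitP (c : nat) (w : seq nat) :
  c \in w -> exists u v, w = u ++ c :: v /\ c \notin v.
Proof.
rewrite -mem_rev => /first_splitP[u [v [e cu]]].
exists (rev v), (rev u); split; last by rewrite mem_rev.
by rewrite -[LHS]revK e rev_cat rev_cons cat_rcons.
Qed.

Lemma quasi_stirling1 (c : nat) : quasi_stirling [:: c].
Proof. by apply/quasi_stirlingP=> x y _; apply/negP=> /size_subseq. Qed.

Section QsSum.
Variable A : comNzRingType.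
Implicit Types (tau : nat -> A) (s u v w : seq nat).

Definition qs_sum tau s : A :=
  \sum_(w <- permutations s | quasi_stirling w) wt tau w.

Lemma qs_sum_perm tau s1 s2 : perm_eq s1 s2 -> qs_sum tau s1 = qs_sum tau s2.
Proof. by move=> /perm_permutations; apply: perm_big. Qed.

End QsSum.

Lemma permutations_insert (b : nat) (s : seq nat) : b \notin s ->
  perm_eq (permutations (b :: s))
    [seq take i v ++ b :: drop i v | v <- permutations s,
                                     i <- iota 0 (size s).+1].
Proof.
move=> bs; apply: uniq_perm; first exact: permutations_uniq.
  apply: allpairs_uniq; rewrite ?permutations_uniq ?iota_uniq //.
  move=> [v i] [v' i'] /allpairsP[[v1 i1] [sv1 li1 [-> ->]]].
  move=> /allpairsP[[v2 i2] [sv2 li2 [-> ->]]] /= e.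
  rewrite mem_permutations in sv1; rewrite mem_permutations in sv2.
  rewrite mem_iota in li1; rewrite mem_iota in li2.
  have nb x j : perm_eq x s -> b \notin take j x.
    by move=> /perm_mem xs; apply: contra bs => /mem_take; rewrite xs.
  have := congr1 (first_split b) e; rewrite !first_splitE ?nb // => -[et ed].
  have -> : v1 = v2 by rewrite -(cat_take_drop i1 v1) et ed cat_take_drop.
  have := congr1 size et; rewrite !size_takel ?(perm_size sv1) ?(perm_size sv2).
  - by move=> ->.
  - by move: li2 => /=; lia.
  - by move: li1 => /=; lia.
move=> w; rewrite mem_permutations; apply/idP/allpairsP => [ws|].
  have [u [v [ew bu]]] : exists u v, w = u ++ b :: v /\ b \notin u.
    by apply: first_splitP; rewrite (perm_mem ws) inE eqxx.
  have uvs : perm_eq (u ++ v) s.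
    by rewrite -(perm_cons b) -(permPr ws) ew perm_sym perm_catC /= perm_cons
       perm_catC.
  exists (u ++ v, size u); split.
  - by rewrite mem_permutations.
  - by rewrite mem_iota -(perm_size uvs) size_cat /=; lia.
  by rewrite /= take_size_cat // drop_size_cat.
case=> -[v i] [+ _ ->] /=; rewrite mem_permutations => vs.
by rewrite perm_catC /= perm_cons perm_catC cat_take_drop.
Qed.

(** A letter of multiplicity one never takes part in a crossing, so every place
    of insertion is allowed. *)
Lemma qs_sum_insert_max (A : comNzRingType) (tau : nat -> A) (b : nat)
    (s : seq nat) : all (fun x => x < b)%N s ->
  qs_sum tau (b :: s) = tau 1%N * qs_sum tau s + (qs_sum (grow tau) s)`_1.
Proof.
move=> sb; have bs : b \notin s.
  by apply/negP=> /(allP sb); rewrite ltnn.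
rewrite /qs_sum coef_sum mulr_sumr -big_split /=.
rewrite (perm_big _ (permutations_insert bs)) big_mkcond big_allpairs_dep.
rewrite [RHS]big_mkcond big_seq [RHS]big_seq; apply: eq_bigr => v.
rewrite mem_permutations => vs; have vb : all (fun x => x < b)%N v.
  by rewrite (perm_all _ vs).
have qs_ins i : quasi_stirling (take i v ++ b :: drop i v) = quasi_stirling v.
  rewrite -cat1s quasi_stirling_factor ?cat_take_drop ?quasi_stirling1 ?andbT //.
  by move=> c; rewrite inE => /eqP->; rewrite (perm_mem vs).
rewrite (eq_bigr _ (fun i _ =>
  congr1 (fun q : bool => if q then _ else 0) (qs_ins i))).
case: ifP => _; last by rewrite big1.
rewrite -(perm_size vs) -[(size v).+1]subn0 -/(index_iota 0 (size v).+1) big_mkord.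
exact: wt_insert_max.
Qed.

(** * The rotation separating two letters *)

(** In a quasi-Stirling word this says that all occurrences of [b] precede all
    those of [a], and that the first of them begins the word. The defaults make
    the test fail on words without [a] or [b]. *)
Definition canonical (a b : nat) (w : seq nat) : bool :=
  (head a w == b) && (last b (filter (pred2 a b) w) == a).

Section Canonical.
Variables (a b : nat).
Hypothesis ab : a != b.
Implicit Types (s u v w : seq nat).

Lemma filter_pred2_nil u :
  a \notin u -> b \notin u -> filter (pred2 a b) u = [::].
Proof.
move=> au bu; rewrite -(filter_pred0 u); apply: eq_in_filter => c cu /=.
by apply/norP; split; [apply: contra au | apply: contra bu] => /eqP <-.
Qed.

Lemma canonical_rotr_ex w : a \in w -> b \in w ->
  exists2 i, (i < size w)%N & canonical a b (rotr i w).
Proof.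
move=> aw bw.
suff [u [v [-> c]]] : exists u v, w = u ++ v /\ canonical a b (v ++ u).
  case: u c => [|x u] c; last first.
    by exists (size v); rewrite ?rotr_size_cat // size_cat /= ltnS leq_addl.
  exists 0%N; last by rewrite /rotr subn0 rot_size -[v]cats0.
  by case: v c => //; rewrite /canonical /= (negPf ab).
have [x [y [ew ay]]] := last_splitP aw.
(* The rotation begins at the first [b] cyclically after the last [a]. *)
have [by_|by_] := boolP (b \in y).
  have [y1 [y2 [ey by1]]] := first_splitP by_.
  exists (x ++ a :: y1), (b :: y2); rewrite ew ey -catA; split=> //.
  rewrite /canonical /= eqxx !filter_cat /= eqxx orbT.
  rewrite (@filter_pred2_nil y1) //; last first.
    by move: ay; rewrite ey mem_cat => /norP[].
  by rewrite /= !last_cat.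
have bx : b \in x.
  by move: bw; rewrite ew mem_cat inE eq_sym (negPf ab) (negPf by_) !orbF.
have [x1 [x2 [ex bx1]]] := first_splitP bx.
exists x1, (b :: x2 ++ a :: y); rewrite ew ex -catA; split=> //.
rewrite /canonical /= eqxx !filter_cat /= eqxx orbT (@filter_pred2_nil y) //.
rewrite /= !last_cat /=.
case/lastP E: (filter _ x1) => [|z c] //=; rewrite last_rcons.
have: c \in filter (pred2 a b) x1 by rewrite E mem_rcons inE eqxx.
by rewrite mem_filter /= => /andP[/orP[]// /eqP->]; rewrite (negPf bx1).
Qed.

Lemma canonical_catr u v :
  a \notin v -> b \notin v -> canonical a b (b :: u ++ a :: v).
Proof.
move=> av bv; rewrite /canonical /= eqxx orbT filter_cat /= eqxx.
by rewrite last_cat /= filter_pred2_nil.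
Qed.

Lemma canonical_suffix u v : canonical a b (u ++ v) -> b \in v -> a \in v.
Proof.
move=> /andP[_]; rewrite filter_cat last_cat => + bv.
case E: (filter _ v) => [|c s].
  suff: b \in filter (pred2 a b) v by rewrite E.
  by rewrite mem_filter bv /= eqxx orbT.
rewrite last_cons => /eqP la; have: last c s \in filter (pred2 a b) v.
  by rewrite E mem_last.
by rewrite la mem_filter => /andP[].
Qed.


Lemma canonical_subseq u : canonical a b u -> subseq [:: b; a] u.
Proof.
case: u => [|c u] cu; first by move: cu; rewrite /canonical /= (negPf ab).
have cb : c = b by case/andP: cu => /eqP.
have := @canonical_suffix [::] (c :: u) cu.
by rewrite cb /= eqxx sub1seq !inE eqxx (negPf ab) => /(_ isT).
Qed.

(** Two different such rotations would show the pattern [baba]. *)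
Lemma canonical_rotr_inj w i j : quasi_stirling w ->
  (i < size w)%N -> (j < size w)%N ->
  canonical a b (rotr i w) -> canonical a b (rotr j w) -> i = j.
Proof.
wlog ij : i j / (i < j)%N.
  move=> h qw iw jw ci cj; case: (ltngtP i j) => // ji; first exact: h ji _ _ _ _ _.
  by apply/esym; apply: h ji _ _ _ _ _.
move=> qw iw jw ci cj; exfalso; move: qw cj ci.
rewrite -(quasi_stirling_rot (size w - j)%N).
rewrite -/(rotr j w) => qw cj.
have -> : rotr i w = rot (j - i) (rotr j w).
  by rewrite /rotr -rotD; first (congr rot; lia); lia.
have: (0 < j - i < size (rotr j w))%N by rewrite size_rotr; lia.
move: (rotr j w) (j - i)%N cj qw => u k cu qu /andP[k0 ku].
move: cu qu; rewrite /rot -{1 2}(cat_take_drop k u).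
case: (take k u) (size_takel (ltnW ku)) => [/= e|c x _]; first by move: k0; rewrite -e.
case: (drop k u) (size_drop k u) => [/= e|d y _]; first by move: ku; lia.
move=> cxy qxy cyx.
have cx : c = b by move: cxy => /andP[/eqP].
have cy : d = b by move: cyx => /andP[/eqP].
have sx : subseq [:: b; a] (c :: x).
  apply: canonical_subseq; move: cyx; rewrite /canonical /= cx cy eqxx.
  by rewrite filter_cat /= ?eqxx ?orbT /= last_cat.
have sy : subseq [:: b; a] (d :: y).
  apply: canonical_subseq; move: cxy; rewrite /canonical /= cx cy eqxx.
  by rewrite filter_cat /= ?eqxx ?orbT /= last_cat.
have ba : b != a by rewrite eq_sym.
move/negP: (elimT (quasi_stirlingP _) qxy b a ba); apply.
exact: (cat_subseq sx sy).
Qed.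

End Canonical.

Lemma rot_permutations (i : nat) (s : seq nat) :
  perm_eq (permutations s) [seq rot i w | w <- permutations s].
Proof.
apply: uniq_perm; first exact: permutations_uniq.
  by rewrite map_inj_uniq ?permutations_uniq //; apply: rot_inj.
move=> w; rewrite mem_permutations; apply/idP/mapP => [ws|[v + ->]].
  exists (rotr i w); last by rewrite rotrK.
  by rewrite mem_permutations; apply: perm_trans ws; rewrite perm_rotr.
by rewrite mem_permutations => vs; rewrite perm_rot.
Qed.

(** Rotating a word of a given cyclic class to its unique canonical form [w]
    leaves the place where the original began, and there [w] is cut in two. No
    descent is lost: the canonical form begins with a maximum. *)
Lemma qs_sum_canonical (A : comNzRingType) (tau : nat -> A) (a b : nat)
    (s : seq nat) :
    a != b -> a \in s -> b \in s -> all (fun x => x <= b)%N s ->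
  qs_sum tau s =
    \sum_(w <- permutations s | quasi_stirling w && canonical a b w)
       cuts tau (wt tau) w.
Proof.
move=> ab sa sb smax.
transitivity (\sum_(w <- permutations s | quasi_stirling w)
    \sum_(i < size s | canonical a b (rotr i w)) wt tau w).
  rewrite /qs_sum big_seq_cond [RHS]big_seq_cond; apply: eq_bigr => w.
  rewrite mem_permutations => /andP[ws qw].
  rewrite -!(perm_mem ws) in sa sb.
  have [i iw ci] := canonical_rotr_ex ab sa sb; rewrite (perm_size ws) in iw.
  rewrite (big_pred1 (Ordinal iw)) // => j /=; apply/idP/eqP => [cj|-> //].
  apply: val_inj; apply: (canonical_rotr_inj ab qw _ _ cj ci).
    by rewrite (perm_size ws).
  by rewrite (perm_size ws).
transitivity (\sum_(i < size s) \sum_(w <- permutations s |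
    quasi_stirling w && canonical a b w) wt tau (rot i w)).
  rewrite (exchange_big_dep xpredT) //=; apply: eq_bigr => i _.
  rewrite (perm_big _ (rot_permutations i s)) big_map.
  by apply: eq_bigl => w; rewrite quasi_stirling_rot rotK.
rewrite exchange_big big_seq_cond [RHS]big_seq_cond.
apply: eq_bigr => w; rewrite mem_permutations => /and3P[ws _ cw].
rewrite /cuts (perm_size ws); apply: eq_bigr => i _.
rewrite /rot wt_cat 1?mulrC //; apply: ascent_take.
have : all (fun x => x <= b)%N (drop i w).
  by apply/allP => x /mem_drop xw; apply: (allP smax); rewrite -(perm_mem ws).
by case: w cw {ws} => // c w /andP[/= /eqP-> _]; apply: ascent_cons_max.
Qed.

(** * Turning one occurrence of a letter into another letter *)

(** The first chunk [b :: X] becomes [a :: X] and joins the chunks starting with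
    [a], just before the last of them, [a :: Z]. If the part [P] in between ends
    in [b], there is only one [a], and the run through that [b] and this [a] has
    to keep its continuation [Z]; then [a :: X] goes to the end instead. *)
Definition shift (a b : nat) (w : seq nat) : seq nat :=
  let (X, S) := first_split b (behead w) in
  let (P, Z) := last_split a (b :: S) in
  if last a P == b then P ++ a :: Z ++ a :: X else P ++ a :: X ++ a :: Z.

Definition unshift (a b : nat) (u : seq nat) : seq nat :=
  let (Q, Z) := last_split a u in
  let (P, X) := last_split a Q in
  if last a P == b then b :: Z ++ P ++ a :: X else b :: X ++ P ++ a :: Z.

(** The shape of a canonical quasi-Stirling word [b :: X ++ P ++ a :: Z]; the
    last condition excludes the crossing [baba]. The conditions are symmetric in
    [X] and [Z], so they serve both cases and both directions of the bijection. *)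
Record shiftable (a b : nat) (X P Z : seq nat) : Prop := Shiftable {
  shiftable_neq : a != b;
  shiftable_head : exists S, P = b :: S;
  shiftable_aX : a \notin X;
  shiftable_bX : b \notin X;
  shiftable_aZ : a \notin Z;
  shiftable_bZ : b \notin Z;
  shiftable_last : last a P = b -> a \notin P }.

(** A letter in a gap between two copies of [c] and also outside crosses [c]. *)
Lemma gap_disjoint (c : nat) (u x v : seq nat) :
  c \notin x -> quasi_stirling (u ++ c :: x ++ c :: v) ->
  forall d, d \in x -> d \notin u ++ c :: v.
Proof.
move=> cx /quasi_stirlingP qs d dx.
have dc : d != c by apply: contraNneq cx => <-.
rewrite mem_cat inE (negPf dc) /=; apply/norP; split; apply/negP => dm.
  apply/(negP (qs d c dc)); rewrite -cat1s; apply: cat_subseq.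
    by rewrite sub1seq.
  rewrite /= eqxx -cat1s; apply: cat_subseq; first by rewrite sub1seq.
  by rewrite /= eqxx sub0seq.
have cd : c != d by rewrite eq_sym.
apply/(negP (qs c d cd)).
apply: subseq_trans (suffix_subseq u _); rewrite /= eqxx -cat1s.
apply: cat_subseq; first by rewrite sub1seq.
by rewrite /= eqxx sub1seq.
Qed.

Lemma head_last_subseq (b d : nat) (P S : seq nat) :
  P = b :: S -> last d P = b -> d != b -> d \in P -> subseq [:: b; d; b] P.
Proof.
move=> ->; case/lastP: S => [|T c].
  by rewrite inE => _ /negPf->.
rewrite last_cons last_rcons inE mem_rcons inE => -> /negPf db.
rewrite !db /= eqxx => dT; rewrite -cats1 -cat1s.
by apply: cat_subseq; rewrite sub1seq // inE.
Qed.

Section Shiftable.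
Variables (a b : nat) (X P Z : seq nat).
Hypothesis sh : shiftable a b X P Z.

Lemma shiftE :
  shift a b (b :: X ++ P ++ a :: Z) =
    if last a P == b then P ++ a :: Z ++ a :: X else P ++ a :: X ++ a :: Z.
Proof.
case: sh => ab [S eP] aX bX aZ bZ _.
rewrite /shift [behead _]/= eP cat_cons first_splitE //.
by rewrite -cat_cons last_splitE.
Qed.

Lemma unshiftE :
  unshift a b (P ++ a :: X ++ a :: Z) =
    if last a P == b then b :: Z ++ P ++ a :: X else b :: X ++ P ++ a :: Z.
Proof.
case: sh => ab [S eP] aX bX aZ bZ _.
by rewrite /unshift -cat_cons catA last_splitE // last_splitE.
Qed.

Let dup_b T : quasi_stirling ([:: b] ++ P ++ T) = quasi_stirling (P ++ T).
Proof.
by case: sh => _ [S ->] *; apply: (quasi_stirling_dup b [::] (S ++ T)).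
Qed.

Let gapX : quasi_stirling (b :: X ++ P ++ a :: Z) ->
  forall d, d \in X -> d \notin P ++ a :: Z.
Proof.
case: sh => _ [S ->] _ bX _ _ _ qs; rewrite -[_ ++ _]cat0s.
exact: (gap_disjoint bX).
Qed.

(** In both words [X] sits in a gap between two equal letters, so it shares no
    letter with the rest and can be moved freely; what remains differs only in
    which letter is doubled. *)
Lemma quasi_stirling_shift_inner :
  last a P != b ->
  quasi_stirling (b :: X ++ P ++ a :: Z) =
    quasi_stirling (P ++ a :: X ++ a :: Z).
Proof.
case: sh => ab [S eP] aX bX aZ bZ _ lP.
have core : (forall d, d \in X -> d \notin P ++ a :: Z) ->
    quasi_stirling (b :: X ++ P ++ a :: Z) =
    quasi_stirling (P ++ a :: X ++ a :: Z).
  move=> dX; rewrite -cat1s quasi_stirling_factor; last first.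
    move=> d dx; rewrite inE negb_or dX // andbT.
    by apply: contraNneq bX => <-.
  rewrite dup_b.
  rewrite -[in RHS]cat_rcons [RHS]quasi_stirling_factor; last first.
    move=> d dx; rewrite cat_rcons; have := dX d dx.
    by rewrite !mem_cat !inE !negb_or => /and3P[-> -> ->].
  by rewrite cat_rcons quasi_stirling_dup.
apply/idP/idP => qs; [rewrite -core // | rewrite core //]; move: qs.
  exact: gapX.
exact: gap_disjoint.
Qed.

(** Here [P] begins and ends with [b], so in both words [X] and [Z] share no
    letter with the rest, and both words are reduced to [rcons P a]. *)
Lemma quasi_stirling_shift_last :
  last a P = b ->
  quasi_stirling (b :: X ++ P ++ a :: Z) =
    quasi_stirling (P ++ a :: Z ++ a :: X).
Proof.
case: sh => ab [S eP] aX bX aZ bZ aP lP.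
have core : (forall d, d \in X -> d \notin P ++ a :: Z) ->
    (forall d, d \in Z -> d \notin P ++ a :: X) ->
    quasi_stirling (b :: X ++ P ++ a :: Z) =
    quasi_stirling (P ++ a :: Z ++ a :: X).
  move=> dX dZ; rewrite -cat1s quasi_stirling_factor; last first.
    move=> d dx; rewrite inE negb_or dX // andbT.
    by apply: contraNneq bX => <-.
  rewrite dup_b.
  have split_a T : (forall d, d \in T -> d \notin P ++ [:: a]) ->
      quasi_stirling (P ++ a :: T) =
      quasi_stirling (rcons P a) && quasi_stirling T.
    move=> dT; rewrite -cat_rcons -[T in LHS]cats0 quasi_stirling_factor cats0 //.
    by rewrite -cats1.
  rewrite split_a; last first.
    move=> d /dZ; rewrite !mem_cat !inE !negb_or => /and3P[-> -> _] //.
  rewrite -[in RHS]cat_rcons quasi_stirling_factor; last first.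
    move=> d /dZ; rewrite cat_rcons !mem_cat !inE !negb_or.
    by move=> /and3P[-> -> ->].
  rewrite cat_rcons quasi_stirling_dup split_a; last first.
    by move=> d /dX; rewrite !mem_cat !inE !negb_or => /and3P[-> -> _].
  by rewrite -!andbA [X in _ && X]andbC.
have disjP T w : quasi_stirling w -> subseq (P ++ T) w -> b \notin T ->
    forall d, d \in T -> d \notin P.
  move=> /quasi_stirlingP qs PT bT d dT; have db : b != d.
    by apply: contraNneq bT => ->.
  apply/negP=> dP; apply/(negP (qs b d db)); apply: subseq_trans PT.
  rewrite -[[:: b; d; b; d]]/([:: b; d; b] ++ [:: d]); apply: cat_subseq.
    by apply: (head_last_subseq eP); rewrite 1?eq_sym // -lP eP.
  by rewrite sub1seq.
have bP : b \in P by rewrite eP inE eqxx.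
apply/idP/idP => qs; [rewrite -core // | rewrite core //].
- exact: gapX.
- move=> d dZ; have dX := gapX qs.
  rewrite mem_cat inE !negb_or; apply/and3P; split.
  + apply: (disjP (a :: Z) _ qs) => //; rewrite ?inE ?dZ ?orbT //.
      exact: (suffix_subseq (b :: X)).
    by rewrite negb_or eq_sym ab.
  + by apply: contraNneq aZ => <-.
  + apply: contraL dZ => /dX; rewrite mem_cat inE !negb_or.
    by case/and3P.
- move=> d dX; have dZ := gap_disjoint aZ qs.
  rewrite mem_cat inE !negb_or; apply/and3P; split.
  + apply: (disjP (a :: X) _ qs) => //; rewrite ?inE ?dX ?orbT //.
      rewrite cat_subseq //= eqxx.
      by apply: subseq_trans (suffix_subseq Z _); apply: subseq_cons.
    by rewrite negb_or eq_sym ab.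
  + by apply: contraNneq aX => <-.
  + apply: contraL dX => /dZ; rewrite mem_cat inE !negb_or.
    by case/and3P.
exact: gap_disjoint aZ qs.
Qed.

Lemma shift_perm :
  perm_eq (a :: X ++ P ++ a :: Z) (shift a b (b :: X ++ P ++ a :: Z)).
Proof.
rewrite shiftE; apply/permP => q.
by case: ifP => _; rewrite /= !count_cat /= !count_cat /=; lia.
Qed.

Lemma canonical_shift : canonical a b (shift a b (b :: X ++ P ++ a :: Z)).
Proof.
rewrite shiftE; case: sh => ab [S ->] aX bX aZ bZ _; rewrite !cat_cons.
case: ifP => _; first by rewrite (catA S (a :: Z)) canonical_catr.
by rewrite (catA S (a :: X)) canonical_catr.
Qed.

Lemma canonical_unshift : canonical a b (b :: X ++ P ++ a :: Z).
Proof. by case: sh => ab _ aX bX aZ bZ _; rewrite catA canonical_catr. Qed.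

Lemma quasi_stirling_shift :
  quasi_stirling (shift a b (b :: X ++ P ++ a :: Z)) =
    quasi_stirling (b :: X ++ P ++ a :: Z).
Proof.
rewrite shiftE; case: eqP => [/quasi_stirling_shift_last -> //|/eqP].
by move=> /quasi_stirling_shift_inner ->.
Qed.

Lemma shiftable_sym : shiftable a b Z P X.
Proof. by case: sh => *; split. Qed.

End Shiftable.

Lemma shiftK (a b : nat) (X P Z : seq nat) : shiftable a b X P Z ->
  unshift a b (shift a b (b :: X ++ P ++ a :: Z)) = b :: X ++ P ++ a :: Z.
Proof.
move=> sh; rewrite (shiftE sh); case: ifP => lP.
  by rewrite (unshiftE (shiftable_sym sh)) lP.
by rewrite (unshiftE sh) lP.
Qed.

Lemma unshiftP (a b : nat) (X P Z : seq nat) : shiftable a b X P Z ->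
  exists X' Z', [/\ shiftable a b X' P Z',
    unshift a b (P ++ a :: X ++ a :: Z) = b :: X' ++ P ++ a :: Z' &
    shift a b (b :: X' ++ P ++ a :: Z') = P ++ a :: X ++ a :: Z].
Proof.
move=> sh; have sh' := shiftable_sym sh; rewrite (unshiftE sh).
case: ifP => lP; [exists Z, X | exists X, Z]; split=> //.
  by rewrite (shiftE sh') lP.
by rewrite (shiftE sh) lP.
Qed.

Lemma canonical_shiftable (a b : nat) (w : seq nat) :
  a != b -> quasi_stirling w -> canonical a b w -> (1 < count_mem b w)%N ->
  exists X P Z, w = b :: X ++ P ++ a :: Z /\ shiftable a b X P Z.
Proof.
move=> ab qw cw; have ba : b != a by rewrite eq_sym.
have noba u : subseq [:: b; a; b; a] u -> ~~ quasi_stirling u.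
  by move=> su; apply: contraL su => /quasi_stirlingP; apply.
case: w qw cw => [|c w] qw cw //=; have cb : c = b by case/andP: cw => /eqP.
subst c; rewrite eqxx ltnS -has_count has_pred1 => /first_splitP[X [S [ew bX]]].
have aS : a \in b :: S.
  have := @canonical_suffix a b (b :: X) (b :: S).
  by rewrite cat_cons -ew cw inE eqxx => /(_ isT isT).
have [P [Z [eS aZ]]] := last_splitP aS.
exists X, P, Z; rewrite ew eS; split=> //.
have [S' eP] : exists S', P = b :: S'.
  case: P eS {aS} => [|d P] /= [eb]; first by rewrite eb eqxx in ab.
  by exists P; rewrite eb.
split=> //; first by exists S'.
- apply: contraL qw => aX; apply: noba; rewrite ew /= eqxx -cat1s.
  apply: cat_subseq; rewrite ?sub1seq //= eqxx sub1seq.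
  by move: aS; rewrite inE (negPf ab).
- apply: contra aZ => bZ.
  have := @canonical_suffix a b (b :: X ++ rcons P a) Z.
  by rewrite cat_cons -catA cat_rcons -eS -ew cw bZ => /(_ isT isT).
- move=> lP; apply: contraL qw => aP; apply: noba; rewrite ew eS.
  apply: subseq_trans (suffix_subseq (b :: X) _).
  rewrite -[[:: b; a; b; a]]/([:: b; a; b] ++ [:: a]); apply: cat_subseq.
    exact: (head_last_subseq eP).
  by rewrite sub1seq inE eqxx.
Qed.

Lemma canonical_unshiftable (a b : nat) (u : seq nat) :
  a != b -> quasi_stirling u -> canonical a b u -> (1 < count_mem a u)%N ->
  exists X P Z, u = P ++ a :: X ++ a :: Z /\ shiftable a b X P Z.
Proof.
move=> ab qu cu; have ba : b != a by rewrite eq_sym.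
have noba w : subseq [:: b; a; b; a] w -> ~~ quasi_stirling w.
  by move=> sw; apply: contraL sw => /quasi_stirlingP; apply.
move=> ca; have /last_splitP[Q [Z [eu aZ]]] : a \in u.
  by rewrite -has_pred1 has_count; apply: ltnW.
have /last_splitP[P [X [eQ aX]]] : a \in Q.
  move: ca; rewrite eu count_cat /= eqxx (count_memPn aZ) addn1 ltnS.
  by rewrite -has_count has_pred1.
have {}eu : u = P ++ a :: X ++ a :: Z by rewrite eu eQ -catA.
exists X, P, Z; split=> //.
have [S eP] : exists S, P = b :: S.
  case: P eu cu {eQ} => [|d P] -> /andP[/= /eqP db _].
    by rewrite db eqxx in ab.
  by exists P; rewrite db.
split=> //; first by exists S.
- apply: contraL qu => bX; apply: noba; rewrite eu eP /= eqxx.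
  apply: subseq_trans (suffix_subseq S _); rewrite /= eqxx.
  rewrite -cat1s; apply: cat_subseq; first by rewrite sub1seq.
  by rewrite sub1seq inE eqxx.
- apply: contra aZ => bZ.
  have := @canonical_suffix a b (P ++ a :: rcons X a) Z.
  by rewrite -catA cat_cons cat_rcons -eu cu bZ => /(_ isT isT).
- move=> lP; apply: contraL qu => aP; apply: noba; rewrite eu.
  rewrite -[[:: b; a; b; a]]/([:: b; a; b] ++ [:: a]); apply: cat_subseq.
    exact: (head_last_subseq eP).
  by rewrite sub1seq inE eqxx.
Qed.

Section Transfer.
Variable A : comNzRingType.
Implicit Type tau : nat -> A.

Lemma cuts_wt_cat tau u v : ascent u v ->
  cuts tau (wt tau) (u ++ v) =
    cuts tau (wt tau) u * wt tau v + wt tau u * cuts tau (wt tau) v.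
Proof. by apply: cuts_cat => u' _ /wt_cat->. Qed.

Lemma wt_head tau (a b : nat) u :
    all (fun x => x < a)%N u -> all (fun x => x < b)%N u ->
  wt tau (a :: u) = wt tau (b :: u).
Proof.
by case: u => // c u /andP[ca _] /andP[cb _]; rewrite /wt !runs_cons /= ca cb.
Qed.

Lemma cuts_wt_head tau (a b : nat) u :
    all (fun x => x < a)%N u -> all (fun x => x < b)%N u ->
  cuts tau (wt tau) (a :: u) = cuts tau (wt tau) (b :: u).
Proof.
move=> ua ub; rewrite /cuts /= !big_ord_recl /= !(wt_head tau ua ub).
congr (_ + _); apply: eq_bigr => i _; congr (_ * _); apply: wt_head.
  by apply/allP => x /mem_take; apply: (allP ua).
by apply/allP => x /mem_take; apply: (allP ub).
Qed.

(** The factors into which [X] and [Z] with their first letters cut the two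
    words are never joined by a descent, and [cuts] does not see their order.
    When [P] ends in [b], there is a descent from [P] to [a :: Z]; the two then
    form a single factor. *)
Lemma cuts_shift tau (a b : nat) (X P Z : seq nat) :
    (a < b)%N -> shiftable a b X P Z ->
    {in b :: X ++ P ++ a :: Z, forall x, (x <= a)%N || (x == b)} ->
  cuts tau (wt tau) (shift a b (b :: X ++ P ++ a :: Z)) =
    cuts tau (wt tau) (b :: X ++ P ++ a :: Z).
Proof.
move=> ab sh le; rewrite (shiftE sh).
case: sh => nab [S eP] aX bX aZ bZ aP.
have inw x : x \in X ++ P ++ a :: Z -> (x <= a)%N || (x == b).
  by move=> xw; apply: le; rewrite inE xw orbT.
have lt_a T : a \notin T -> b \notin T -> {subset T <= X ++ P ++ a :: Z} ->
    all (fun x => x < a)%N T.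
  move=> aT bT sT; apply/allP => x xT.
  case/orP: (inw x (sT x xT)) => [|/eqP xb]; last by rewrite -xb xT in bT.
  by rewrite leq_eqVlt => /orP[/eqP xa|//]; rewrite -xa xT in aT.
have Xa : all (fun x => x < a)%N X.
  by apply: lt_a => // x xX; rewrite mem_cat xX.
have Za : all (fun x => x < a)%N Z.
  by apply: lt_a => // x xZ; rewrite !mem_cat inE xZ !orbT.
have Xb : all (fun x => x < b)%N X.
  by apply: sub_all Xa => x xa; apply: ltn_trans ab.
have asc T V : all (fun x => x < a)%N T -> ascent (a :: T) (a :: V).
  move=> Ta; apply: ascent_cons_max; rewrite /= leqnn /=.
  by apply: sub_all Ta => x; apply: ltnW.
have -> : cuts tau (wt tau) (b :: X ++ P ++ a :: Z) =
    cuts tau (wt tau) (a :: X) * wt tau (P ++ a :: Z) +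
    wt tau (a :: X) * cuts tau (wt tau) (P ++ a :: Z).
  rewrite -cat_cons cuts_wt_cat; last first.
    rewrite eP cat_cons; apply: ascent_cons_max; rewrite /= leqnn /=.
    by apply: sub_all Xb => x; apply: ltnW.
  by rewrite (cuts_wt_head tau Xa Xb) (wt_head tau Xa Xb).
case: eqP => [lP|/eqP lP].
  rewrite -[P ++ a :: Z ++ _]/(P ++ (a :: Z) ++ (a :: X)) catA cuts_wt_cat.
    by ring.
  by rewrite /ascent last_cat; apply: (asc Z).
have aP' V : ascent P (a :: V).
  have lP' : last a P \in P by rewrite eP /= mem_last.
  have := inw (last a P); rewrite !mem_cat lP' orbT (negPf lP) orbF.
  by move=> /(_ isT); rewrite eP.
rewrite -[P ++ a :: X ++ _]/(P ++ (a :: X) ++ (a :: Z)) !cuts_wt_cat //.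
- by rewrite !wt_cat ?asc ?aP' //; ring.
- exact: asc.
- exact: (aP' (X ++ a :: Z)).
Qed.

(** That another [b] remains is used to close the gap [X] behind the [b] that is
    changed. *)
Lemma qs_sum_transfer tau (a b p q : nat) (s : seq nat) :
    (a < b)%N -> all (fun x => x < a)%N s ->
  qs_sum tau (nseq p.+1 a ++ nseq q.+2 b ++ s) =
    qs_sum tau (nseq p.+2 a ++ nseq q.+1 b ++ s).
Proof.
move=> ab sa; have nab : a != b by rewrite neq_ltn ab.
have le p' q' : {in nseq p' a ++ nseq q' b ++ s, forall x, (x <= a)%N || (x == b)}.
  move=> x; rewrite !mem_cat !mem_nseq => /or3P[/andP[_ /eqP->]|/andP[_ ->]|].
  - by rewrite leqnn.
  - by rewrite orbT.
  by move=> /(allP sa) /ltnW ->.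
have maxb p' q' : all (fun x => x <= b)%N (nseq p' a ++ nseq q' b ++ s).
  apply/allP => x /le /orP[xa|/eqP-> //].
  exact: leq_trans xa (ltnW ab).
rewrite !(@qs_sum_canonical _ tau a b) //; last first.
all: rewrite ?mem_cat ?mem_nseq ?eqxx ?orbT //.
rewrite -big_filter -[RHS]big_filter.
have cnt (w : seq nat) p' q' : perm_eq w (nseq p' a ++ nseq q' b ++ s) ->
    count_mem a w = p' /\ count_mem b w = q'.
  move=> /permP e; rewrite !e !count_cat !count_nseq /= !eqxx.
  rewrite (negPf nab) eq_sym (negPf nab) !mul1n !mul0n.
  have ns c : (a <= c)%N -> count_mem c s = 0%N.
    move=> ac; apply/count_memPn/negP => /(allP sa); lia.
  by rewrite !ns //; lia.
(* In passing from [w] to [u], the first letter [b] is exchanged for an [a]. *)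
have permS (w u : seq nat) : perm_eq (a :: behead w) u -> head a w = b ->
    perm_eq w (nseq p.+1 a ++ nseq q.+2 b ++ s) =
    perm_eq u (nseq p.+2 a ++ nseq q.+1 b ++ s).
  case: w => [|c w] /= wu cb; first by rewrite cb eqxx in nab.
  subst c; rewrite -(perm_cons a).
  have /permPl-> : perm_eq [:: a, b & w] (b :: u).
    by rewrite (perm_catCA [:: a] [:: b] w) /= perm_cons.
  have /permPr-> : perm_eq (a :: nseq p.+1 a ++ nseq q.+2 b ++ s)
                           (b :: nseq p.+2 a ++ nseq q.+1 b ++ s).
    by apply/permP => x; rewrite /= !count_cat /= !count_nseq; lia.
  by rewrite perm_cons.
apply: (reindex_seq (f := shift a b) (g := unshift a b));
  rewrite ?filter_uniq ?permutations_uniq //.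
  move=> w; rewrite mem_filter mem_permutations => /andP[/andP[qw cw] ws].
  have [|X [P [Z [ew sh]]]] := canonical_shiftable nab qw cw.
    by have [_ ->] := cnt _ _ _ ws.
  have pe := shift_perm sh; subst w; split; last 1 first.
  - by rewrite cuts_shift // => x; rewrite (perm_mem ws); apply: le.
  - rewrite mem_filter mem_permutations quasi_stirling_shift // qw.
    by rewrite canonical_shift //= -(@permS (b :: X ++ P ++ a :: Z)).
  exact: shiftK.
move=> u; rewrite mem_filter mem_permutations => /andP[/andP[qu cu] us].
have [|X [P [Z [eu sh]]]] := canonical_unshiftable nab qu cu.
  by have [-> _] := cnt _ _ _ us.
have [X' [Z' [sh' eg e]]] := unshiftP sh; have pe := shift_perm sh'.
rewrite e in pe; subst u; rewrite eg e; split=> //.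
rewrite mem_filter mem_permutations -(quasi_stirling_shift sh') e qu.
by rewrite (canonical_unshift sh') (permS (b :: X' ++ P ++ a :: Z') _ pe).
Qed.

Lemma qs_sum_merge tau (a b p q : nat) (s : seq nat) :
    (a < b)%N -> all (fun x => x < a)%N s ->
  qs_sum tau (nseq p.+1 a ++ nseq q.+1 b ++ s) =
    qs_sum tau (b :: nseq (p + q).+1 a ++ s).
Proof.
move=> ab sa; elim: q p => [|q IH] p.
  rewrite addn0; apply: qs_sum_perm.
  by apply/permPl/(perm_catCA (nseq p.+1 a) [:: b] s).
by rewrite qs_sum_transfer // IH addSnnS.
Qed.

End Transfer.

(** * Collapsing the multiplicities into the smallest letter *)

Lemma msetS (n : nat) (k : nat -> nat) :
  mset n.+1 k = mset n k ++ nseq (k n.+1) n.+1.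
Proof. by rewrite /mset -{1}[n.+1]addn1 iotaD map_cat flatten_cat /= cats0 add1n. Qed.

Lemma eq_mset (n : nat) (k k' : nat -> nat) :
  (forall l, (1 <= l <= n)%N -> k l = k' l) -> mset n k = mset n k'.
Proof.
move=> e; rewrite /mset; congr flatten; apply/eq_in_map => l.
by rewrite mem_iota => lin; rewrite e //; lia.
Qed.

Lemma mem_mset (n : nat) (k : nat -> nat) (x : nat) :
  x \in mset n k -> (1 <= x <= n)%N.
Proof.
move=> /flattenP[s /mapP[l + ->]]; rewrite mem_iota mem_nseq => lin.
by move=> /andP[_ /eqP->]; lia.
Qed.

Lemma mset_lt (n : nat) (k : nat -> nat) :
  all (fun x => x < n.+1)%N (mset n k).
Proof. by apply/allP => x /mem_mset /andP[]. Qed.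

Definition repeat1 (m l : nat) : nat := if l == 1%N then m else 1%N.

Lemma mset_repeat1S (m n : nat) :
  perm_eq (mset n.+2 (repeat1 m)) (n.+2 :: mset n.+1 (repeat1 m)).
Proof. by rewrite msetS perm_catC. Qed.

(** Merge the two largest letters, delete the largest, collapse the rest by
    induction and insert the largest again. The insertion changes the weights, so
    the induction hypothesis is needed for [tau] and for [grow tau]. *)
Lemma qs_sum_mset (n : nat) (A : comNzRingType) (tau : nat -> A)
    (k : nat -> nat) :
    (forall l, (1 <= l <= n.+1)%N -> (0 < k l)%N) ->
  qs_sum tau (mset n.+1 k) =
    qs_sum tau (mset n.+1 (repeat1 (\sum_(1 <= l < n.+2) k l - n)%N)).
Proof.
elim: n A tau k => [|n IH] A tau k k0.
  by rewrite big_nat1 subn0; congr qs_sum.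
pose k' l := if l == n.+1 then (k n.+1 + k n.+2).-1 else k l.
have k1 := k0 n.+1 ltac:(lia); have k2 := k0 n.+2 ltac:(lia).
have -> : qs_sum tau (mset n.+2 k) = qs_sum tau (n.+2 :: mset n.+1 k').
  transitivity (qs_sum tau (nseq (k n.+1).-1.+1 n.+1 ++
      nseq (k n.+2).-1.+1 n.+2 ++ mset n k)).
    apply: qs_sum_perm; rewrite !msetS !prednK //; apply/permP => x.
    by rewrite !count_cat; lia.
  rewrite qs_sum_merge ?mset_lt //; apply: qs_sum_perm; rewrite perm_cons msetS.
  rewrite perm_catC {2}/k' eqxx; apply: perm_cat; last first.
    by rewrite (_ : (_ + _).+1 = (k n.+1 + k n.+2).-1) //; lia.
  rewrite (@eq_mset n k' k) // => l lin; rewrite /k'; case: eqP => // e; lia.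
have k'0 l : (1 <= l <= n.+1)%N -> (0 < k' l)%N.
  by move=> lin; rewrite /k'; case: eqP => _; [lia | apply: k0; lia].
rewrite (qs_sum_perm _ (mset_repeat1S _ _)) !qs_sum_insert_max ?mset_lt //.
rewrite !(IH _ _ _ k'0).
suff -> : (\sum_(1 <= l < n.+2) k' l - n = \sum_(1 <= l < n.+3) k l - n.+1)%N by [].
have ek : (\sum_(1 <= l < n.+1) k' l = \sum_(1 <= l < n.+1) k l)%N.
  by apply: eq_big_nat => l lin; rewrite /k'; case: eqP => // e; lia.
rewrite [LHS](_ : _ = \sum_(1 <= l < n.+1) k' l + k' n.+1 - n)%N; last first.
  by rewrite big_nat_recr.
rewrite ek {1}/k' eqxx [in RHS]big_nat_recr //= [in RHS]big_nat_recr //=; lia.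
Qed.

(** * The runs counted by positions *)

Section Positions.
Implicit Types (u v w : seq nat).

Definition descent w l : bool := (nth 0 w l.+1 < nth 0 w l)%N.

(** Maximality of a decreasing factor tested only at its two ends, which makes it
    compatible with concatenation. *)
Definition is_run w i j : bool :=
  [&& (i <= j)%N, all (descent w) (iota i (j - i)),
      (i == 0)%N || ~~ descent w i.-1 & (j.+1 == size w) || ~~ descent w j].

Lemma decreasing_factorE w (p : 'I_(size w) * 'I_(size w)) :
  decreasing_factor p =
    (p.1 <= p.2)%N && all (descent w) (iota p.1 (p.2 - p.1)).
Proof.
case: p => i j; rewrite /decreasing_factor /=; have [ij|//] := leqP i j.
have jw := ltn_ord j.
apply/(sortedP 0%N)/allP => [h l|h l].
  rewrite mem_iota => lin; have := h (l - i)%N.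
  rewrite size_takel ?size_drop; last lia.
  rewrite !nth_take ?nth_drop; try lia.
  by rewrite addnS subnKC; [apply; lia | lia].
rewrite size_takel ?size_drop => [lt|]; last lia.
rewrite !nth_take ?nth_drop; try lia.
by have := h (i + l)%N; rewrite /descent addnS; apply; rewrite mem_iota; lia.
Qed.

Lemma decreasing_runE w (p : 'I_(size w) * 'I_(size w)) :
  decreasing_run p = is_run w p.1 p.2.
Proof.
rewrite /decreasing_run /is_run decreasing_factorE -!andbA.
case: p => i j /=; have [ij|//] := leqP i j; congr (_ && _).
case: (boolP (all _ _)) => //= dij.
have iw := ltn_ord i; have jw := ltn_ord j.
apply/forallP/andP => [mx|[li rj] [i' j']].
  split.
    case: eqP => //= /eqP i0; apply/negP => di.
    have i'w : (i.-1 < size w)%N by lia.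
    have := mx (Ordinal i'w, j); rewrite decreasing_factorE /= leqnn leq_pred /=.
    have -> : (i.-1 <= j)%N by lia.
    have -> : (j - i.-1 = (j - i).+1)%N by lia.
    rewrite /= di prednK ?lt0n // dij /= => /eqP[].
    by move/(congr1 (@nat_of_ord _)) => /= e; lia.
  case: eqP => //= /eqP jn; apply/negP => dj.
  have j'w : (j.+1 < size w)%N by lia.
  have := mx (i, Ordinal j'w); rewrite decreasing_factorE /= leqnn leqnSn /=.
  have -> : (i <= j.+1)%N by lia.
  have -> : (j.+1 - i = j - i + 1)%N by lia.
  rewrite iotaD all_cat dij /= subnKC // dj /= => /eqP[].
  by move/(congr1 (@nat_of_ord _)) => /= e; lia.
rewrite decreasing_factorE /=; apply/implyP => /and4P[ii jj i'j' d].
have d' l : (i' <= l < j')%N -> descent w l.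
  by move=> lin; apply: (allP d); rewrite mem_iota; lia.
have -> : i' = i.
  apply/val_inj/eqP; rewrite /= eqn_leq ii /= leqNgt; apply/negP => lt.
  case/orP: li => [/eqP|/negP[]]; first lia.
  by apply: d'; lia.
have -> // : j' = j.
apply/val_inj/eqP; rewrite /= eqn_leq jj andbT leqNgt; apply/negP => lt.
have jw' := ltn_ord j'.
case/orP: rj => [/eqP|/negP[]]; first lia.
by apply: d'; lia.
Qed.

Lemma num_runsE w j :
  num_runs w j =
    (\sum_(i < size w) \sum_(i' < size w) (is_run w i i' && ((i' - i).+1 == j)))%N.
Proof.
rewrite /num_runs pair_big /= -sum1dep_card big_mkcond /=.
by apply: eq_bigr => p _; rewrite decreasing_runE; case: ifP.
Qed.

Lemma num_runs_cat u v j : ~~ nilp u -> sorted gtn u -> ascent u v ->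
  num_runs (u ++ v) j = ((size u == j) + num_runs v j)%N.
Proof.
move=> nu su auv; rewrite !num_runsE size_cat big_split_ord /=.
have u0 : (0 < size u)%N by rewrite lt0n.
have du l : (l.+1 < size u)%N -> descent (u ++ v) l.
  move=> lu; rewrite /descent !nth_cat lu (ltnW lu).
   by move/(sortedP 0%N): su => /(_ l lu).
have duv : (0 < size v)%N -> ~~ descent (u ++ v) (size u).-1.
  have lu : ((size u).-1 < size u)%N by rewrite prednK.
  rewrite /descent !nth_cat lu prednK // ltnn subnn nth_last nth0 -leqNgt.
  by move: auv; rewrite /ascent; case: (v).
have nthv l : nth 0%N (u ++ v) (size u + l) = nth 0%N v l.
  by rewrite nth_cat ltnNge leq_addr /= addKn.
have dv l : descent (u ++ v) (size u + l) = descent v l.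
  by rewrite /descent -addnS !nthv.
have first_run i i' : (i < size u)%N -> (i' < size u + size v)%N ->
    is_run (u ++ v) i i' = (i == 0%N) && (i' == (size u).-1).
  move=> iu iuv; rewrite /is_run size_cat; apply/and4P/andP => [|[/eqP-> /eqP->]].
    case=> ii' /allP d di ri.
    have i0 : i = 0%N.
      by apply/eqP; case: eqP di => // i0 /= /negP[]; apply: du; lia.
    rewrite i0 eqxx; split=> //; rewrite eqn_leq; apply/andP; split.
      rewrite leqNgt; apply/negP => lt.
      by have /negP[] := duv ltac:(lia); apply: d; rewrite mem_iota; lia.
    rewrite leqNgt; apply/negP => lt.
    by case/orP: ri => [/eqP|/negP[]]; [lia | apply: du; lia].
  split=> //; first by apply/allP => l; rewrite mem_iota => lt; apply: du; lia.
  rewrite prednK //; have [v0|v0] := posnP (size v); first by rewrite v0 addn0 eqxx.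
  by rewrite duv ?orbT.
have shifted_run i i' : (i < size v)%N ->
    is_run (u ++ v) (size u + i) (size u + i') = is_run v i i'.
  move=> iv; rewrite /is_run leq_add2l subnDl size_cat -addnS eqn_add2l dv.
  rewrite iotaDl all_map (eq_all (a2 := descent v)); last by move=> l /=; rewrite dv.
  congr [&& _, _, _ & _]; case: i iv => [|i] iv; last by rewrite addnS /= dv.
  by rewrite addn0 duv ?orbT.
congr (_ + _)%N.
  rewrite (bigD1 (Ordinal u0)) //= [X in (_ + X)%N]big1 ?addn0; last first.
    move=> i i0; apply: big1 => i' _; rewrite first_run //.
    by rewrite (_ : (i == 0%N :> nat) = false) //; apply: contraNF i0.
  have luv : ((size u).-1 < size u + size v)%N by rewrite prednK // leq_addr.
  rewrite (bigD1 (Ordinal luv)) //= big1 ?addn0; last first.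
    move=> i' i'0; rewrite first_run //.
    by rewrite (_ : (i' == _ :> nat) = false) //; apply: contraNF i'0.
  by rewrite first_run //= !eqxx subn0 prednK.
apply: eq_bigr => i _; rewrite big_split_ord /= big1 ?add0n.
  by apply: eq_bigr => i' _; rewrite shifted_run // subnDl.
move=> i' _; rewrite /is_run leqNgt ltn_addr //.
Qed.

Lemma count_runs j w : num_runs w j = count_mem j (runs w).
Proof.
elim/runs_ind: w => [|u v nu su auv IH].
  by rewrite num_runsE big_ord0.
by rewrite num_runs_cat // runs_cat // runs_decreasing //= IH.
Qed.

End Positions.

Lemma prod_count (A : comNzRingType) (F : nat -> A) (n : nat) (s : seq nat) :
  all (fun l => (1 <= l <= n)%N) s ->
  \prod_(1 <= j < n.+1) F j ^+ count_mem j s = \prod_(l <- s) F l.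
Proof.
elim: s => [_|l s IH /= /andP[ln sn]]; first by rewrite big_nil big1.
rewrite big_cons -IH // [LHS](eq_bigr (fun j =>
  F j ^+ (l == j) * F j ^+ count_mem j s)).
  rewrite big_split /=. congr (_ * _).
  rewrite (bigD1_seq l) ?mem_index_iota ?iota_uniq //= eqxx expr1.
  by rewrite big1 ?mulr1 // => j; rewrite eq_sym => /negPf->.
by move=> j _; rewrite exprD.
Qed.

Lemma tDR_wt (n : nat) (k : nat -> nat) (w : seq nat) :
  perm_eq w (mset n k) -> tDR n w = wt t w.
Proof.
move=> wk; have : all (fun x => (1 <= x <= n)%N) w.
  by rewrite (perm_all _ wk); apply/allP => x /mem_mset.
move=> {wk} wn.
have : all (fun l => (1 <= l <= n)%N) (runs w).
  elim/runs_ind: w wn => // u v nu su auv IH; rewrite all_cat => /andP[un /IH vn].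
  rewrite runs_cat // runs_decreasing //= vn andbT lt0n nu /=.
  rewrite -(size_iota 1 n) uniq_leq_size //.
    by apply: sorted_uniq su => [? ? ? h1 h2|?]; [exact: ltn_trans h2 h1 | exact: ltnn].
  by move=> x /(allP un); rewrite mem_iota; lia.
rewrite /tDR /wt (eq_bigr (fun j => t j ^+ count_mem j (runs w))); last first.
  by move=> j _; rewrite count_runs.
exact: prod_count.
Qed.

Lemma rQE (n : nat) (k : nat -> nat) : rQ n k = qs_sum t (mset n k).
Proof.
rewrite /rQ /qs_sum big_seq_cond [RHS]big_seq_cond; apply: eq_bigr => w.
by rewrite mem_permutations => /andP[/tDR_wt-> _].
Qed.

(** * The inverse of the series of weights *)

Section Series.
Variable A : comNzRingType.
Implicit Types (f g : {fps A}) (tau : nat -> A) (x y : nat -> A).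

Lemma fcoefM f g n :
  fcoef (f * g) n = \sum_(i < n.+1) fcoef f i * fcoef g (n - i)%N.
Proof. by []. Qed.

Lemma fcoefD f g n : fcoef (f + g) n = fcoef f n + fcoef g n.
Proof. by []. Qed.

Lemma fcoefN f n : fcoef (- f) n = - fcoef f n.
Proof. by []. Qed.

Lemma fcoef1 n : fcoef (1 : {fps A}) n = (n == 0%N)%:R.
Proof. by []. Qed.

Lemma fcoef_fpsCM (c : A) f n : fcoef (fpsC c * f) n = c * fcoef f n.
Proof.
rewrite fcoefM big_ord_recl /= subn0 big1 ?addr0 // => i _.
by rewrite mul0r.
Qed.

Lemma fcoef_fpsXM f n :
  fcoef (fpsX A * f) n = if n is m.+1 then fcoef f m else 0.
Proof.
rewrite fcoefM; case: n => [|n]; first by rewrite big_ord1 mul0r.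
rewrite !big_ord_recl /= mul0r mul1r add0r subSS subn0 big1 ?addr0 // => i _.
by rewrite mul0r.
Qed.

Lemma fpsCN (c : A) : fpsC (- c) = - fpsC c.
Proof. by apply/fpsP => -[|n]; rewrite fcoefN /= ?oppr0. Qed.

Lemma fpsC1B (c : A) : fpsC (1 - c) = 1 - fpsC c.
Proof. by apply/fpsP => -[|n]; rewrite fcoefD fcoefN /= ?subr0. Qed.

Definition fps_tail f : {fps A} := Fps (fun n => fcoef f n.+1).

Lemma fps_tailM f g :
  fps_tail (f * g) = fpsC (fcoef f 0) * fps_tail g + fps_tail f * g.
Proof.
apply/fpsP => n; rewrite fcoefD fcoef_fpsCM.
by rewrite [LHS]fcoefM big_ord_recl subn0.
Qed.

Definition Hser tau : {fps A} := Fps (hcoef tau).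

Definition Vser tau : {fps A} := (Hser tau)^-1.

Lemma VserH tau : Vser tau * Hser tau = 1.
Proof. by apply/mulVr/fps_unitP; exists 1; rewrite mul1r. Qed.

Lemma Vser0 tau : fcoef (Vser tau) 0 = 1.
Proof. by have := fcoef_mul0 (Vser tau) (Hser tau); rewrite VserH /= mulr1. Qed.

Lemma fps_tail_Vser tau :
  fps_tail (Vser tau) = - (fps_tail (Hser tau) * Vser tau).
Proof.
have := fps_tailM (Hser tau) (Vser tau); rewrite mulrC VserH.
have -> : fps_tail 1 = 0 by apply/fpsP.
have -> : fpsC (fcoef (Hser tau) 0) = 1 by apply/fpsP => -[].
by move=> /esym/eqP; rewrite mul1r addr_eq0 => /eqP.
Qed.

Lemma Vser1 tau : fcoef (Vser tau) 1 = - tau 1%N.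
Proof.
have := congr1 (fun f => fcoef f 0) (fps_tail_Vser tau).
by rewrite fcoefN fcoef_mul0 Vser0 mulr1.
Qed.

End Series.

Section Coefficients.
Variable A : comNzRingType.
Implicit Types (tau : nat -> A) (x y : nat -> A).

Definition fps_coef (i : nat) (f : {fps {poly A}}) : {fps A} :=
  Fps (fun n => (fcoef f n)`_i).

Lemma fps_coef0M (f g : {fps {poly A}}) :
  fps_coef 0 (f * g) = fps_coef 0 f * fps_coef 0 g.
Proof.
apply/fpsP => n; rewrite [LHS]/= coef_sum; apply: eq_bigr => i _.
exact: coef0M.
Qed.

Lemma fps_coef1M (f g : {fps {poly A}}) :
  fps_coef 1 (f * g) =
    fps_coef 0 f * fps_coef 1 g + fps_coef 1 f * fps_coef 0 g.
Proof.
apply/fpsP => n; rewrite fcoefD !fcoefM -big_split [LHS]/= coef_sum.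
by apply: eq_bigr => i _; apply: coef1M.
Qed.

Lemma fps_coef0_Hser tau : fps_coef 0 (Hser (grow tau)) = Hser tau.
Proof.
apply/fpsP => n; rewrite /= /hcoef; case: ifP => _; first exact: coef1.
exact: grow0.
Qed.

(** The derivation that inserts a maximum, read on generating functions. *)
Lemma fps_coef1_Hser tau :
  fps_coef 1 (Hser (grow tau)) =
    Hser tau * fps_tail (Hser tau) - fpsC (tau 1%N) * Hser tau.
Proof.
apply/fpsP => n; rewrite fcoefD fcoefN fcoef_fpsCM fcoefM big_ord_recr /=.
rewrite subnn [hcoef tau 1]/= [hcoef tau n * _]mulrC addrK.
rewrite {1}/hcoef; case: eqP => [->|_].
  by rewrite coef1 big_ord0.
rewrite grow1; apply: eq_bigr => i _; congr (_ * _).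
by rewrite subSn // ltnW.
Qed.

Lemma fps_coef0_Vser tau : fps_coef 0 (Vser (grow tau)) = Vser tau.
Proof.
have := congr1 (fps_coef 0) (VserH (grow tau)).
rewrite fps_coef0M fps_coef0_Hser.
have -> : fps_coef 0 1 = 1 by apply/fpsP => -[|n]; rewrite /= ?coef1 ?coef0.
move=> e; rewrite -[LHS]mulr1 -(VserH tau) [Vser tau * _]mulrC mulrA e.
exact: mul1r.
Qed.

(** The derivation applied to [V * H = 1] and solved for the derivative of [V]. *)
Lemma fps_coef1_Vser tau :
  fps_coef 1 (Vser (grow tau)) =
    fps_tail (Vser tau) + fpsC (tau 1%N) * Vser tau.
Proof.
have := congr1 (fps_coef 1) (VserH (grow tau)).
rewrite fps_coef1M fps_coef0_Hser fps_coef0_Vser fps_coef1_Hser.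
have -> : fps_coef 1 1 = 0 by apply/fpsP => -[|n]; rewrite /= ?coef1 ?coef0.
rewrite fps_tail_Vser; set V := Vser tau; set H := Hser tau.
have VH : V * H = 1 := VserH tau.
set U := fps_coef 1 _; set T := fps_tail H; set c := fpsC _ => e.
rewrite -[U]mulr1 -VH.
have -> : U * (V * H) = V * (V * (H * T - c * H) + U * H) -
   (V * H) * (V * T) + c * ((V * H) * V) by ring.
by rewrite e VH; ring.
Qed.

Lemma Vser_grow0 tau m :
  (fcoef (Vser (grow tau)) m)`_0 = fcoef (Vser tau) m.
Proof. by rewrite -(fps_coef0_Vser tau). Qed.

Lemma Vser_grow1 tau m :
  (fcoef (Vser (grow tau)) m)`_1 =
    fcoef (Vser tau) m.+1 + tau 1%N * fcoef (Vser tau) m.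
Proof.
have := congr1 (fun f => fcoef f m) (fps_coef1_Vser tau).
by rewrite fcoefD fcoef_fpsCM.
Qed.

(** * Binomial convolutions *)

(** The product of exponential generating functions, without the denominators. *)
Definition conv x y (n : nat) : A :=
  \sum_(i < n.+1) (x i * y (n - i)%N) *+ 'C(n, i).

Lemma convS x y n :
  conv x y n.+1 = conv (x \o succn) y n + conv x (y \o succn) n.
Proof.
rewrite /conv big_ord_recl bin0 mulr1n subn0 /=.
under eq_bigr => i _ do rewrite /= binS mulrnDr subSS.
rewrite big_split /= addrA addrC; congr (_ + _).
rewrite [RHS]big_ord_recl bin0 mulr1n subn0 /=; congr (_ + _).
rewrite big_ord_recr /= bin_small // mulr0n addr0; apply: eq_bigr => i _.
by rewrite /bump /= subnSK.
Qed.

End Coefficients.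

(** If a derivation acts on [x] as the shift plus [c] and on [y] as the shift minus
    [c], the multiples of [c] cancel in the Leibniz rule and the derivation shifts
    the convolution. *)
Lemma conv_grow (A : comNzRingType) (c : A) (x y : nat -> A)
    (x' y' : nat -> {poly A}) (n : nat) :
    (forall m, (x' m)`_0 = x m) -> (forall m, (y' m)`_0 = y m) ->
    (forall m, (x' m)`_1 = x m.+1 + c * x m) ->
    (forall m, (y' m)`_1 = y m.+1 - c * y m) ->
  (conv x' y' n)`_1 = conv x y n.+1.
Proof.
move=> x0 y0 x1 y1; rewrite convS /conv coef_sum -big_split /=.
apply: eq_bigr => i _; rewrite coefMn coef1M x0 y0 x1 y1 -mulrnDl.
by congr (_ *+ _); ring.
Qed.

(** * The recurrence *)

Definition qs_repeat1 (A : comNzRingType) (tau : nat -> A) (k n : nat) : A :=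
  qs_sum tau (mset n.+1 (repeat1 k)).

Definition qs_repeat1_pred (A : comNzRingType) (tau : nat -> A) (k n : nat) : A :=
  if k is j.+1 then qs_repeat1 tau j n else 0.

Section Recurrence.
Variable A : comNzRingType.
Implicit Types (tau : nat -> A).

Lemma qs_repeat1_grow0 tau k n : (qs_repeat1 (grow tau) k n)`_0 = qs_repeat1 tau k n.
Proof.
by rewrite /qs_repeat1 /qs_sum coef_sum; apply: eq_bigr => w _; apply: wt_grow0.
Qed.

Lemma qs_repeat1_grow1 tau k n :
  (qs_repeat1 (grow tau) k n)`_1 =
    qs_repeat1 tau k n.+1 - tau 1%N * qs_repeat1 tau k n.
Proof.
rewrite /qs_repeat1 (qs_sum_perm _ (mset_repeat1S _ _)).
by rewrite qs_sum_insert_max ?mset_lt // addrC addKr.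
Qed.

Lemma qs_repeat1S tau k n :
  qs_repeat1 tau k n.+1 =
    tau 1%N * qs_repeat1 tau k n + (qs_repeat1 (grow tau) k n)`_1.
Proof. by rewrite qs_repeat1_grow1 addrC subrK. Qed.

Lemma qs_repeat1_0 tau k : qs_repeat1 tau k 0 = tau 1%N ^+ k.
Proof.
rewrite /qs_repeat1 /qs_sum [mset _ _]cats0 /repeat1 /=.
have -> : permutations (nseq k 1%N) = [:: nseq k 1%N].
  apply: perm_small_eq => //; rewrite uniq_perm ?permutations_uniq // => w.
  rewrite mem_permutations inE; apply/idP/eqP => [wk|-> //].
  rewrite -(size_nseq k 1%N) -(perm_size wk); apply/all_pred1P.
  by rewrite (perm_all _ wk) all_pred1_nseq.
rewrite big_cons big_nil; have -> : quasi_stirling (nseq k 1%N).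
  apply/quasi_stirlingP => x y xy; apply/negP => /mem_subseq s.
  have := s x; have := s y; rewrite !inE !eqxx !orbT !mem_nseq.
  move=> /(_ isT)/andP[_ /eqP yx] /(_ isT)/andP[_ /eqP xx].
  by rewrite yx xx eqxx in xy.
rewrite addr0; elim: k => [|k IH]; first by rewrite wt_nil.
rewrite -[nseq k.+1 _]/([:: 1%N] ++ nseq k 1%N) wt_cat; last by case: k {IH}.
by rewrite IH exprS wt_decreasing.
Qed.

End Recurrence.

(** The derivation that inserts a maximum raises [n] by one on the left, and it
    kills the constant on the right; [n = 0] is the case of the words [1 ... 1]. *)
Lemma qs_repeat1_conv (A : comNzRingType) (tau : nat -> A) (k n : nat) :
  conv (fcoef (Vser tau)) (qs_repeat1 tau k) n +
  conv (fcoef (fps_tail (Vser tau))) (qs_repeat1_pred tau k) n =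
    ((n == 0%N) && (k == 0%N))%:R.
Proof.
elim: n A tau => [|n IH] A tau.
  rewrite /conv !big_ord1 bin0 !mulr1n Vser0 [fcoef (fps_tail _) 0]Vser1 mul1r.
  case: k => [|k]; first by rewrite qs_repeat1_0 mulr0 addr0.
  by rewrite /= !qs_repeat1_0 exprS mulNr subrr.
have := congr1 (fun p : {poly A} => p`_1) (IH _ (grow tau)).
rewrite /= coefD.
rewrite (@conv_grow _ (tau 1%N) (fcoef (Vser tau)) (qs_repeat1 tau k)) //; first last.
- exact: qs_repeat1_grow1.
- exact: Vser_grow1.
- exact: qs_repeat1_grow0.
- exact: Vser_grow0.
rewrite (@conv_grow _ (tau 1%N) (fcoef (fps_tail (Vser tau))) (qs_repeat1_pred tau k)).
- by move=> ->; case: (_ && _); rewrite ?coef1 ?coef0.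
- by move=> m; apply: Vser_grow0.
- by move=> m; case: (k) => [|j]; [apply: coef0 | apply: qs_repeat1_grow0].
- by move=> m; apply: Vser_grow1.
move=> m; case: (k) => [|j]; last exact: qs_repeat1_grow1.
by rewrite /= coef0 mulr0 subrr.
Qed.

Lemma qs_repeat1_01 (A : comNzRingType) (tau : nat -> A) (n : nat) :
  qs_repeat1 tau 0 n.+1 = qs_repeat1 tau 1 n.
Proof.
elim: n A tau => [|n IH] A tau; last by rewrite qs_repeat1S !IH -qs_repeat1S.
by rewrite qs_repeat1S !qs_repeat1_0 !expr0 coef1 addr0 mulr1.
Qed.

(** [qs_repeat1_conv] solved for its term with [fcoef (Vser tau) 0 = 1]. *)
Lemma qs_repeat1_recurrence (A : comNzRingType) (tau : nat -> A) (k n : nat) :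
  qs_repeat1 tau k.+1 n =
    \sum_(i < n.+1) - fcoef (Vser tau) i.+1 *
      ('C(n, i.+1)%:R * qs_repeat1 tau k.+1 (n - i.+1)%N
       + 'C(n, i)%:R * qs_repeat1 tau k (n - i)%N).
Proof.
have := qs_repeat1_conv tau k.+1 n; rewrite andbF => /eqP; rewrite addr_eq0.
rewrite /conv big_ord_recl bin0 mulr1n Vser0 mul1r subn0 /=.
move=> /eqP e; rewrite -[LHS](addrK
  (\sum_(i < n)
    (fcoef (Vser tau) i.+1 * qs_repeat1 tau k.+1 (n - i.+1)%N) *+ 'C(n, i.+1))).
rewrite e -opprD.
have -> : \sum_(i < n)
    (fcoef (Vser tau) i.+1 * qs_repeat1 tau k.+1 (n - i.+1)%N) *+ 'C(n, i.+1) =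
  \sum_(i < n.+1)
    (fcoef (Vser tau) i.+1 * qs_repeat1 tau k.+1 (n - i.+1)%N) *+ 'C(n, i.+1).
  by rewrite big_ord_recr /= bin_small // mulr0n addr0.
rewrite -big_split -sumrN; apply: eq_bigr => i _ /=.
by rewrite !mulr_natl mulNr mulrDr !mulrnAr addrC.
Qed.

(** * Exponential generating functions *)

Section Egf.
Variable A : comAlgType rat.
Implicit Types x y : nat -> A.

Definition egf x : {fps A} := Fps (fun n => (n`!%:R)^-1 *: x n).

Lemma egfM x y : egf x * egf y = egf (conv x y).
Proof.
apply/fpsP => n; rewrite fcoefM /= /conv scaler_sumr; apply: eq_bigr => i _.
have ni : (i <= n)%N by rewrite -ltnS.
rewrite -scalerAl -scalerAr scalerA -scaler_nat scalerA; congr (_ *: _).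
rewrite -(bin_fact ni) !natrM !invfM mulrAC mulVf ?mul1r //.
by rewrite pnatr_eq0 -lt0n bin_gt0.
Qed.

Lemma egf_deriv x : fps_deriv (egf x) = egf (x \o succn).
Proof.
apply/fpsP => n; rewrite /= -scaler_nat scalerA; congr (_ *: _).
by rewrite factS natrM invfM mulrA mulfV ?mul1r // pnatr_eq0.
Qed.

Lemma egfD x y : egf (fun n => x n + y n) = egf x + egf y.
Proof. by apply/fpsP => n; rewrite fcoefD /= scalerDr. Qed.

End Egf.

Lemma egf_repeat1 (A : comAlgType rat) (tau : nat -> A) :
  (Fps (fun k => egf (qs_repeat1 tau k)) : {fps {fps A}}) *
    (fpsC (egf (fcoef (Vser tau)))
     + fpsX _ * fpsC (egf (fcoef (fps_tail (Vser tau))))) = 1.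
Proof.
apply/fpsP => k; rewrite mulrC mulrDl -mulrA fcoefD fcoef_fpsCM fcoef_fpsXM.
rewrite egfM fcoef1; case: k => [|k].
  rewrite addr0; apply/fpsP => n /=; have := qs_repeat1_conv tau 0 n.
  rewrite andbT [conv (fcoef (fps_tail _)) _ _]big1 ?addr0; last first.
    by move=> i _; rewrite mulr0 mul0rn.
  move=> ->; case: n => [|n] /=; last by rewrite scaler0.
  by rewrite fact0 invr1 scale1r.
rewrite fcoef_fpsCM egfM -egfD /=; apply/fpsP => n /=.
by rewrite (qs_repeat1_conv tau k.+1 n) andbF scaler0.
Qed.

(** * The generating function *)

Lemma r_qs_repeat1 (n k : nat) : r n.+1%:Z k%:Z = qs_repeat1 t k n.
Proof. exact: rQE. Qed.

Lemma r0 (n k : int) : (n <= 0) || (k < 0) -> r n k = 0.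
Proof.
by move=> nk; rewrite /r; case: ifP => //; case/andP; case/orP: nk; lia.
Qed.

Lemma WS (m : nat) : W m.+1 = - fcoef (Vser t) m.+1.
Proof. exact: add0r. Qed.

Lemma r_recurrence (n k : nat) : (1 <= n)%N -> (1 <= k)%N ->
  r n%:Z k%:Z =
    \sum_(1 <= m < n.+1)
      W m * ('C(n.-1, m)%:R * r (n%:Z - m%:Z) k%:Z
             + 'C(n.-1, m.-1)%:R * r (n%:Z - m%:Z + 1) (k%:Z - 1)).
Proof.
case: n k => [|n] [|k] // _ _.
rewrite r_qs_repeat1 qs_repeat1_recurrence big_add1 big_mkord.
apply: eq_bigr => i _; have ni : (i <= n)%N by rewrite -ltnS.
rewrite WS.
have -> : r (n.+1%:Z - i.+1%:Z + 1) (k.+1%:Z - 1) = qs_repeat1 t k (n - i)%N.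
  by rewrite -r_qs_repeat1; congr r; lia.
have -> : 'C(n.+1.-1, i.+1)%:R * r (n.+1%:Z - i.+1%:Z) k.+1%:Z =
    'C(n, i.+1)%:R * qs_repeat1 t k.+1 (n - i.+1)%N.
  have [->|ni'] := eqVneq (i : nat) n; first by rewrite (bin_small (ltnSn n)) !mul0r.
  by rewrite -r_qs_repeat1; congr (_ * r _ _); lia.
by [].
Qed.

Lemma rQ_collapse (n : nat) (k : nat -> nat) :
  (1 <= n)%N -> (forall l : nat, (1 <= l <= n)%N -> (0 < k l)%N) ->
  rQ n k = r n%:Z ((\sum_(1 <= l < n.+1) k l)%N%:Z - n%:Z + 1).
Proof.
case: n => // n _ k0; rewrite rQE qs_sum_mset //.
have Kn : (n.+1 <= \sum_(1 <= l < n.+2) k l)%N.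
  have e : (\sum_(1 <= l < n.+2) 1 = n.+1)%N by rewrite sum_nat_const_nat; lia.
  by rewrite -{1}e big_nat [leqRHS]big_nat; apply: leq_sum => l; apply: k0.
have -> : (\sum_(1 <= l < n.+2) k l)%N%:Z - n.+1%:Z + 1 =
    (\sum_(1 <= l < n.+2) k l - n)%N%:Z by lia.
by rewrite r_qs_repeat1.
Qed.

Lemma r_n0 (n : nat) : (2 <= n)%N -> r n%:Z 0 = r (n%:Z - 1) 1.
Proof.
case: n => [|[|n]] // _; rewrite -[0]/(0%:Z) r_qs_repeat1.
have -> : n.+2%:Z - 1 = n.+1%:Z by lia.
by rewrite -[1 in RHS]/(1%:Z) r_qs_repeat1 qs_repeat1_01.
Qed.

Lemma Rser_repeat1 : Rser = xser * Fps (fun k => egf (qs_repeat1 t k)).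
Proof.
apply/fpsP => k; rewrite fcoef_fpsCM; apply/fpsP => n.
rewrite fcoef_fpsXM; case: n => [|n]; first reflexivity.
rewrite [LHS]/=. rewrite [RHS]/=. rewrite -[qs_repeat1 t k n]r_qs_repeat1.
reflexivity.
Qed.

Lemma Wser_egf : 1 - Wser = egf (fcoef (Vser t)).
Proof.
apply/fpsP => -[|n]; rewrite fcoefD fcoefN fcoef1.
  rewrite [fcoef Wser _]/= [RHS]/= Vser0 fact0 invr1 scale1r subr0.
  reflexivity.
rewrite [fcoef Wser _]/= [RHS]/= WS scalerN opprK add0r.
reflexivity.
Qed.

Lemma Wser_deriv_egf : fps_deriv Wser = - egf (fcoef (fps_tail (Vser t))).
Proof.
have -> : Wser = 1 - egf (fcoef (Vser t)) by rewrite -Wser_egf subKr.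
rewrite -[RHS]/(- egf (fcoef (Vser t) \o succn)) -egf_deriv.
apply/fpsP => n; rewrite fcoefN [LHS]/= [fcoef (fps_deriv _) _]/=.
rewrite add0r mulNrn.
reflexivity.
Qed.

Lemma Rser_closed_form :
  Rser = xser / (1 - fpsC Wser - yser * fpsC (fps_deriv Wser)).
Proof.
apply: (canRL (mulrK Rser_denom_unit)); rewrite Rser_repeat1 -mulrA.
have := egf_repeat1 t; rewrite -Wser_egf.
rewrite Wser_deriv_egf fpsC1B fpsCN mulrN opprK => ->.
exact: mulr1.
Qed.

Theorem theorem1p2 :
  (forall (n : nat) (k : nat -> nat),
     (1 <= n)%N ->
     (forall l : nat, (1 <= l <= n)%N -> (0 < k l)%N) ->
     rQ n k = r n%:Z ((\sum_(1 <= l < n.+1) k l)%N%:Z - n%:Z + 1))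
  /\ (forall n k : nat, (1 <= n)%N -> (1 <= k)%N ->
     r n%:Z k%:Z =
       \sum_(1 <= m < n.+1)
         W m * ('C(n.-1, m)%:R * r (n%:Z - m%:Z) k%:Z
                + 'C(n.-1, m.-1)%:R * r (n%:Z - m%:Z + 1) (k%:Z - 1)))
  /\ (forall n : nat, (2 <= n)%N -> r n%:Z 0 = r (n%:Z - 1) 1)
  /\ r 1 0 = 1
  /\ (forall n k : int, (n <= 0) || (k < 0) -> r n k = 0)
  /\ Rser = xser / (1 - fpsC Wser - yser * fpsC (fps_deriv Wser)).
Proof.
split; first exact: rQ_collapse.
split; first exact: r_recurrence.
split; first exact: r_n0.
split; first by rewrite (r_qs_repeat1 0 0) qs_repeat1_0 expr0.
split; first exact: r0.
exact: Rser_closed_form.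
Qed.
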